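(* The j-invariant $j:\mathfrak{O}\to\mathbb{C}$ factors through the projection $\pi:\mathfrak{O}\to\mathcal{M}$, i.e. there is a map $\overline{j}:\mathcal{M}\to\mathbb{C}$ with $j=\overline{j}\circ\pi$. Moreover, $\overline{j}$ is a submersion outside the curve $X\subset\mathcal{M}\subset\mathbb{CP}^2/S_3$ defined by the equation $$(\lambda_1-2\lambda_2+\lambda_3)(\lambda_1+\lambda_2-2\lambda_3)(2\lambda_1-\lambda_2-\lambda_3)\left(\lambda_1^2-\lambda_1\lambda_2-\lambda_1\lambda_3+\lambda_2^2-\lambda_2\lambda_3+\lambda_3^2\right)^2=0 .$$ The critical values of $\overline{j}$ and $j$ are $0$ and $1728$ (the values corresponding to elliptic curves having a special group of automorphisms). Finally, $j$ is a submersion outside the inverse image $\pi^{-1}(X)$.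
   Context: A conic in $\mathbb{CP}^2$ is identified with its symmetric $3\times 3$ complex matrix up to a non-zero scalar. $\mathfrak{O}\subset\mathbb{CP}^5\times\mathbb{CP}^5$ is the open set of pairs $(C,D)$ of non-degenerate conics that intersect transversely, i.e. in four distinct points. $G=\mathbb{P}GL_3(\mathbb{C})$ acts on $\mathfrak{O}$ by congruence, $(C,D)\mapsto(A^TCA,A^TDA)$; $\mathcal{M}=\mathfrak{O}/G$ and $\pi$ is the canonical projection. Sending the orbit of $(C,D)$ to the class $[\lambda_1:\lambda_2:\lambda_3]$ of the three (distinct, non-zero) roots of $\det(tC+D)$ identifies $\mathcal{M}$ with the open subset $U/S_3$ of $\mathbb{CP}^2/S_3$, where $U\subset\mathbb{CP}^2$ is the set of points with distinct non-zero coordinates and $S_3$ permutes coordinates; $\mathcal{M}$ carries the complex structure of this quotient. For $(C,D)\in\mathfrak{O}$, $j(C,D)$ is the j-invariant of the elliptic curve $y^2=\det(xC+D)$, with the normalization that the curve $y^2=x^3+ax^2+bx+c$ has j-invariant $-\dfrac{256(a^2-3b)^3}{4a^3c-a^2b^2-18abc+4b^3+27c^2}$ (and $y^2=\alpha x^3+\beta x^2+\gamma x+\delta$ is isomorphic to $y^2=x^3+\frac{\beta}{\alpha}x^2+\frac{\gamma}{\alpha}x+\frac{\delta}{\alpha}$). *)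

(* Defs.v *)
From HB Require Import structures.
From mathcomp Require Import all_boot all_order all_fingroup all_algebra.
From mathcomp Require Import complex generic_quotient.
From mathcomp Require Import all_classical all_reals all_analysis.

Set Implicit Arguments.
Unset Strict Implicit.
Unset Printing Implicit Defensive.

Import Order.TTheory GRing.Theory Num.Theory.
Import numFieldNormedType.Exports.
Local Open Scope classical_set_scope.
Local Open Scope quotient_scope.
Local Open Scope ring_scope.

(* R[i], declared at type numClosedFieldType: Mathcomp-Analysis puts the normed
   topology on abstract numeric fields, and does not find it on [complex R]. *)
Definition Cx (R : realType) : numClosedFieldType := R[i].

Section Projective.
Context {R : realType}.
Local Notation C := (Cx R).

Definition nzvec (n : nat) := {v : 'rV[C]_n.+1 | v != 0}.

Definition proportional n (u v : nzvec n) : bool :=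
  `[< exists2 c : C, c != 0 & val u = c *: val v >].

Lemma proportional_refl n : reflexive (@proportional n).
Proof. by move=> u; apply/asboolP; exists 1; rewrite ?oner_eq0 ?scale1r. Qed.

Lemma proportional_sym n : symmetric (@proportional n).
Proof.
have H u v : @proportional n u v -> proportional v u.
  move=> /asboolP[c c0 e]; apply/asboolP; exists c^-1; first by rewrite invr_eq0.
  by rewrite e scalerA mulVf // scale1r.
by move=> u v; apply/idP/idP; exact: H.
Qed.

Lemma proportional_trans n : transitive (@proportional n).
Proof.
move=> v u w /asboolP[c c0 e] /asboolP[d d0 e']; apply/asboolP.
by exists (c * d); rewrite ?mulf_neq0 // e e' scalerA.
Qed.

Canonical proportional_equiv n :=
  EquivRel (@proportional n) (@proportional_refl n) (@proportional_sym n)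
           (@proportional_trans n).

Definition CP (n : nat) := {eq_quot (@proportional n)}.

Lemma const1_neq0 n : const_mx 1 != 0 :> 'rV[C]_n.+1.
Proof. by apply/eqP => /rowP /(_ ord0); rewrite !mxE; apply/eqP/oner_neq0. Qed.

(* The point [v_0 : ... : v_n]; a junk value when v = 0. *)
Definition pt n (v : 'rV[C]_n.+1) : CP n :=
  \pi_(CP n) (insubd (Sub (const_mx 1) (const1_neq0 n) : nzvec n) v).

(* A choice of homogeneous coordinates. *)
Definition hc n (p : CP n) : 'rV[C]_n.+1 := val (repr p).

Lemma hc_neq0 n (p : CP n) : hc p != 0.
Proof. exact: valP (repr p). Qed.

Lemma hcK n (p : CP n) : pt (hc p) = p.
Proof. by rewrite /pt /hc valKd reprK. Qed.

Lemma pt_eqP n (u v : 'rV[C]_n.+1) : u != 0 -> v != 0 ->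
  (pt u = pt v) <-> (exists2 c : C, c != 0 & u = c *: v).
Proof.
move=> u0 v0; rewrite /pt; split.
  by move=> /eqmodP /asboolP[c c0]; rewrite !insubdK //; exists c.
move=> [c c0 e]; apply/eqmodP; apply/asboolP; exists c => //.
by rewrite !insubdK.
Qed.

Lemma hc_pt n (v : 'rV[C]_n.+1) : v != 0 ->
  exists2 c : C, c != 0 & hc (pt v) = c *: v.
Proof. by move=> v0; apply/pt_eqP => //; rewrite ?hc_neq0 ?hcK. Qed.

(* Inverse of the k-th affine chart: [w] with the entry 1 inserted at place k. *)
Definition chart n (k : 'I_n.+1) (w : 'rV[C]_n) : CP n :=
  pt (\row_i oapp (w 0) 1 (unlift k i)).

Definition chart2 n (kl : 'I_n.+1 * 'I_n.+1) (w : 'rV[C]_n * 'rV[C]_n) :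
    CP n * CP n :=
  (chart kl.1 w.1, chart kl.2 w.2).

End Projective.

Arguments CP R n : clear implicits.

(* T is described by the parametrizations [atlas i : V -> T] (inverses of
   charts), [f] is a function on T and [x] a point of T. Differentiability and
   differentials are over the field Cx R, hence complex. *)
Section Submersions.
Context {R : realType} (V : normedModType (Cx R)) (I T : Type).
Variable atlas : I -> V -> T.

Definition holomorphic_at (f : T -> Cx R) (x : T) : Prop :=
  forall i v, atlas i v = x -> differentiable (f \o atlas i) v.

Definition submersion_at (f : T -> Cx R) (x : T) : Prop :=
  holomorphic_at f x /\
  forall i v, atlas i v = x ->
    forall z : Cx R, exists u : V, 'd (f \o atlas i) v u = z.

End Submersions.

Section Conics.
Context {R : realType}.
Local Notation C := (Cx R).

Definition entry_index (i j : 'I_3) : 'I_6 :=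
  inord (nth 0%N (nth [::] [:: [:: 0; 1; 2]; [:: 1; 3; 4]; [:: 2; 4; 5]]%N i) j).

Definition sym_mx (v : 'rV[C]_6) : 'M[C]_3 :=
  \matrix_(i, j) v 0 (entry_index i j).

(* Left inverse of [sym_mx]: the upper triangular entries of A. *)
Definition sym_vec (A : 'M[C]_3) : 'rV[C]_6 :=
  \row_k nth 0 [:: A 0 0; A 0 1; A 0 2%R; A 1 1; A 1 2%R; A 2%R 2%R] k.

Definition conic_mx (c : CP R 5) : 'M[C]_3 := sym_mx (hc c).

Definition on_conic (c : CP R 5) (p : CP R 2) : Prop :=
  hc p *m conic_mx c *m (hc p)^T = 0.

Definition nondegenerate (c : CP R 5) : Prop := \det (conic_mx c) != 0.

Definition transverse (c d : CP R 5) : Prop :=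
  ([set p | on_conic c p /\ on_conic d p] #= `I_4)%card.

Definition Opairs : set (CP R 5 * CP R 5) :=
  [set x | [/\ nondegenerate x.1, nondegenerate x.2 & transverse x.1 x.2]].

Definition Omega := {x : CP R 5 * CP R 5 | x \in Opairs}.

Definition congr_conic (A : 'M[C]_3) (c : CP R 5) : CP R 5 :=
  pt (sym_vec (A^T *m conic_mx c *m A)).

Definition congr_pair (A : 'M[C]_3) (x : CP R 5 * CP R 5) : CP R 5 * CP R 5 :=
  (congr_conic A x.1, congr_conic A x.2).

(* Scalar matrices act trivially, so GL_3 and PGL_3 have the same orbits. *)
Definition same_orbit (x y : Omega) : bool :=
  `[< exists2 A : 'M[C]_3, A \in unitmx & val y = congr_pair A (val x) >].

Lemma sym_mxK : cancel sym_mx sym_vec.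
Proof.
move=> v; apply/rowP => k; rewrite !mxE /entry_index.
case: k => [[|[|[|[|[|[|//]]]]]] h] /=; congr (v _ _); apply/val_inj;
  by rewrite /= inordK.
Qed.

Lemma sym_vecK (A : 'M[C]_3) : A^T = A -> sym_mx (sym_vec A) = A.
Proof.
move=> sA; have e i j : A i j = A j i by rewrite -{1}sA mxE.
apply/matrixP => i j; rewrite !mxE /entry_index.
case: i => [[|[|[|//]]] hi]; case: j => [[|[|[|//]]] hj] /=;
  rewrite inordK //=;
  first [ by congr (A _ _); apply/val_inj
        | by rewrite e; congr (A _ _); apply/val_inj ].
Qed.

Lemma sym_mx_sym v : (sym_mx v)^T = sym_mx v.
Proof.
apply/matrixP => i j; rewrite !mxE; congr (v _ _).
by rewrite /entry_index; case: i => [[|[|[|//]]] hi]; case: j => [[|[|[|//]]] hj].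
Qed.

Lemma sym_vecZ a A : sym_vec (a *: A) = a *: sym_vec A.
Proof.
apply/rowP => k; rewrite !mxE.
by case: k => [[|[|[|[|[|[|//]]]]]] h].
Qed.

Lemma sym_mxZ a v : sym_mx (a *: v) = a *: sym_mx v.
Proof. by apply/matrixP => i j; rewrite !mxE. Qed.

Lemma congr_sym (A B : 'M[C]_3) : B^T = B -> (A^T *m B *m A)^T = A^T *m B *m A.
Proof. by move=> e; rewrite !trmx_mul trmxK e mulmxA. Qed.

Lemma congr_vec_neq0 A (c : CP R 5) : A \in unitmx ->
  sym_vec (A^T *m conic_mx c *m A) != 0.
Proof.
move=> uA; apply/eqP => e.
have : A^T *m conic_mx c *m A = 0.
  rewrite -[LHS]sym_vecK ?e; last exact/congr_sym/sym_mx_sym.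
  by apply/matrixP => i j; rewrite !mxE.
move/(congr1 (mulmx (invmx A^T) \o mulmxr (invmx A))) => /=.
rewrite mulmxK // mul0mx mulmx0 mulKmx ?unitmx_tr // => /(congr1 sym_vec).
rewrite sym_mxK => h; move: (hc_neq0 c); rewrite h.
by apply/negP; rewrite negbK; apply/eqP/rowP => k; rewrite !mxE;
  case: k => [[|[|[|[|[|[|//]]]]]] ?].
Qed.

Lemma congr_conic_mx A (c : CP R 5) : A \in unitmx ->
  exists2 a : C, a != 0 &
    conic_mx (congr_conic A c) = a *: (A^T *m conic_mx c *m A).
Proof.
move=> uA; have [a a0 e] := hc_pt (congr_vec_neq0 c uA).
exists a => //; rewrite /conic_mx /congr_conic e sym_mxZ sym_vecK //.
exact/congr_sym/sym_mx_sym.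
Qed.

Lemma congr_conic1 c : congr_conic 1%:M c = c.
Proof. by rewrite /congr_conic trmx1 mul1mx mulmx1 sym_mxK hcK. Qed.

Lemma congr_conicM A B c : A \in unitmx -> B \in unitmx ->
  congr_conic B (congr_conic A c) = congr_conic (A *m B) c.
Proof.
move=> uA uB; have [a a0 e] := congr_conic_mx c uA.
rewrite {1}/congr_conic; apply/pt_eqP.
- exact: congr_vec_neq0.
- by apply: congr_vec_neq0; rewrite unitmx_mul uA.
exists a => //.
by rewrite e trmx_mul -scalemxAr -scalemxAl sym_vecZ !mulmxA.
Qed.

Lemma congr_pair1 x : congr_pair 1%:M x = x.
Proof. by case: x => c d; rewrite /congr_pair !congr_conic1. Qed.

Lemma congr_pairM A B x : A \in unitmx -> B \in unitmx ->
  congr_pair B (congr_pair A x) = congr_pair (A *m B) x.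
Proof. by move=> uA uB; congr pair; exact: congr_conicM. Qed.

Lemma same_orbit_refl : reflexive same_orbit.
Proof.
by move=> x; apply/asboolP; exists 1%:M; rewrite ?unitmx1 ?congr_pair1.
Qed.

Lemma same_orbit_sym : symmetric same_orbit.
Proof.
have H x y : same_orbit x y -> same_orbit y x.
  move=> /asboolP[A uA e]; apply/asboolP; exists (invmx A).
    by rewrite unitmx_inv.
  by rewrite e congr_pairM ?unitmx_inv // mulmxV ?congr_pair1.
by move=> x y; apply/idP/idP; exact: H.
Qed.

Lemma same_orbit_trans : transitive same_orbit.
Proof.
move=> y x z /asboolP[A uA e] /asboolP[B uB e']; apply/asboolP.
exists (A *m B); first by rewrite unitmx_mul uA.
by rewrite e' e congr_pairM.
Qed.

Canonical same_orbit_equiv :=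
  EquivRel same_orbit same_orbit_refl same_orbit_sym same_orbit_trans.

Definition moduli := {eq_quot same_orbit}.

Definition piM (x : Omega) : moduli := \pi_moduli x.

Definition det_pencil (A B : 'M[C]_3) : {poly C} :=
  \det ('X *: map_mx polyC A + map_mx polyC B).

Definition j_cubic (a b c : C) : C :=
  - (256 * (a ^+ 2 - 3 * b) ^+ 3 /
     (4 * a ^+ 3 * c - a ^+ 2 * b ^+ 2 - 18 * a * b * c + 4 * b ^+ 3
      + 27 * c ^+ 2)).

(* A total function, to be used on the open set [Opairs] only; its value there
   does not depend on the representatives chosen by [conic_mx]. *)
Definition j_inv (x : CP R 5 * CP R 5) : C :=
  let p := det_pencil (conic_mx x.1) (conic_mx x.2) in
  j_cubic (p`_2 / p`_3) (p`_1 / p`_3) (p`_0 / p`_3).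

Definition perm_equiv (p q : CP R 2) : bool :=
  `[< exists s : 'S_3, p = pt (col_perm s (hc q)) >].

Lemma col_perm_neq0 (s : 'S_3) (v : 'rV[C]_3) : v != 0 -> col_perm s v != 0.
Proof.
apply: contra => /eqP/rowP h; apply/eqP/rowP => k; rewrite mxE.
by have := h ((s^-1)%g k); rewrite !mxE permKV.
Qed.

Lemma pt_col_permM (s t : 'S_3) (p : CP R 2) :
  pt (col_perm s (hc (pt (col_perm t (hc p))))) = pt (col_perm (s * t)%g (hc p)).
Proof.
have n0 (u : 'S_3) (q : CP R 2) : col_perm u (hc q) != 0
  by apply: col_perm_neq0; exact: hc_neq0.
have [c c0 e] := hc_pt (n0 t p).
apply/pt_eqP => //; exists c => //.
by rewrite e; apply/rowP => k; rewrite !mxE permM.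
Qed.

Lemma perm_equiv_refl : reflexive perm_equiv.
Proof. by move=> p; apply/asboolP; exists 1%g; rewrite col_perm1 hcK. Qed.

Lemma perm_equiv_sym : symmetric perm_equiv.
Proof.
have H p q : perm_equiv p q -> perm_equiv q p.
  move=> /asboolP[s ->]; apply/asboolP; exists (s^-1)%g.
  by rewrite pt_col_permM mulVg col_perm1 hcK.
by move=> p q; apply/idP/idP; exact: H.
Qed.

Lemma perm_equiv_trans : transitive perm_equiv.
Proof.
move=> q p r /asboolP[s ->] /asboolP[t ->]; apply/asboolP.
by exists (s * t)%g; rewrite pt_col_permM.
Qed.

Canonical perm_equiv_equiv :=
  EquivRel perm_equiv perm_equiv_refl perm_equiv_sym perm_equiv_trans.

Definition CP2S3 := {eq_quot perm_equiv}.

Definition piS3 (p : CP R 2) : CP2S3 := \pi_CP2S3 p.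

Definition poly_roots (p : {poly C}) : seq C :=
  sval (closed_field_poly_normal p).

(* The identification of the moduli space with U/S_3: the class of the three
   roots of det(tC + D). *)
Definition root_class (m : moduli) : CP2S3 :=
  let x := val (repr m) in
  let r := poly_roots (det_pencil (conic_mx x.1) (conic_mx x.2)) in
  piS3 (pt (\row_(i < 3) r`_i)).

(* f seen as a function on CP^2/S_3, that is f o root_class^-1 on the image
   U/S_3 of the injective map [root_class]; 0 off U/S_3. *)
Definition on_quotient (f : moduli -> C) (q : CP2S3) : C :=
  xget 0 [set f m | m in [set m | root_class m = q]].

(* The complex structure of CP^2/S_3: a function is holomorphic when its lift to
   CP^2 is. Off the class of [1 : w : w^2], w a primitive cube root of unity
   (the only point of U/S_3 over which S_3 does not act freely), the projection
   U -> U/S_3 is a local biholomorphism; at that class these are the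
   uniformizing charts of the quotient singularity. *)
Definition quotient_chart (k : 'I_3) (w : 'rV[C]_2) : CP2S3 := piS3 (chart k w).

Definition holomorphic_moduli_at (f : moduli -> C) (m : moduli) : Prop :=
  holomorphic_at quotient_chart (on_quotient f) (root_class m).

Definition submersion_moduli_at (f : moduli -> C) (m : moduli) : Prop :=
  submersion_at quotient_chart (on_quotient f) (root_class m).

Definition critical_values_moduli (f : moduli -> C) : set C :=
  [set f m | m in [set m | ~ submersion_moduli_at f m]].

(* Here and below f is a total function on CP^5 x CP^5, of which only the germs
   at points of the open set [Opairs] matter. *)
Definition holomorphic_pairs_at (f : CP R 5 * CP R 5 -> C) (x : Omega) : Prop :=
  holomorphic_at (@chart2 R 5) f (val x).

Definition submersion_pairs_at (f : CP R 5 * CP R 5 -> C) (x : Omega) : Prop :=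
  submersion_at (@chart2 R 5) f (val x).

Definition critical_values_pairs (f : CP R 5 * CP R 5 -> C) : set C :=
  [set f (val x) | x in [set x | ~ submersion_pairs_at f x]].

Definition X_equation (l1 l2 l3 : C) : Prop :=
  (l1 - 2 * l2 + l3) * (l1 + l2 - 2 * l3) * (2 * l1 - l2 - l3) *
  (l1 ^+ 2 - l1 * l2 - l1 * l3 + l2 ^+ 2 - l2 * l3 + l3 ^+ 2) ^+ 2 = 0.

Definition curveX : set moduli :=
  [set m | exists2 l : 'rV[C]_3, l != 0 &
    root_class m = piS3 (pt l) /\ X_equation (l 0 0) (l 0 1) (l 0 2%R)].

End Conics.

Arguments Omega R : clear implicits.
Arguments moduli R : clear implicits.
Arguments CP2S3 R : clear implicits.
Arguments curveX R : clear implicits.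

(* Main.v *)
(* With q = a^2 - 3b, S = 2a^3 - 9ab + 27c and disc the discriminant of
   x^3 + ax^2 + bx + c, one has j = 256 q^3 / disc and
   j - 1728 = 64 S^2 / disc, so every derivative of j vanishes where j is 0 or
   1728; in terms of the roots, q and S are the factors of [X_equation].
   Four common points of a transverse pair (C, D) are in general position, so
   they may be taken to be the coordinate points and [1 : 1 : 1]; then both
   matrices have zero diagonal, det(tC + D) splits into explicit linear factors
   that are distinct (otherwise C = D, which has a fifth point), and changing one
   entry of D moves a single root.  Along such a line j is an explicit rational
   function whose derivative vanishes only on X.  Conversely the same normal form
   realizes any three distinct non-zero roots. *)
Require Import Defs.
From mathcomp Require Import all_boot all_order all_fingroup all_algebra.
From mathcomp Require Import complex generic_quotient ring.
From mathcomp Require Import all_classical all_reals all_analysis.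

Set Implicit Arguments.
Unset Strict Implicit.
Unset Printing Implicit Defensive.

Import Order.TTheory GRing.Theory Num.Theory.
Import numFieldNormedType.Exports.
Local Open Scope classical_set_scope.
Local Open Scope quotient_scope.
Local Open Scope ring_scope.

(** * Differentials of the j-invariant of a cubic *)

Section Differentials.
Context {K : numFieldType} {V : normedModType K}.
Implicit Types (f g h : V -> K) (v u : V).

Lemma near_eq_differentiable f g v :
  (\near v, f v = g v) -> differentiable f v -> differentiable g v.
Proof.
move=> fg /diff_locallyP [cf /eqaddoP ef].
have e : g \o shift v = cst (g v) + 'd f v +o_ (0 : V) id.
  apply/eqaddoP => e e0; have := ef e e0; apply: filter_app.
  have : \forall w \near (0 : V), f (w + v) = g (w + v).
    by move: fg; rewrite {1}(near_shift 0 v) subr0.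
  apply: filter_app; near=> w => /= fgw.
  by rewrite !fctE /= fgw (nbhs_singleton fg).
have E := diff_unique cf e.
by apply/diff_locallyP; rewrite E; split.
Unshelve. all: by end_near. Qed.

Lemma near_eq_diff f g v : (\near v, f v = g v) -> differentiable f v ->
  'd f v = 'd g v :> (V -> K).
Proof.
move=> fg df; apply/funext => u; rewrite -!deriveE //; first exact: near_eq_derive.
exact: near_eq_differentiable df.
Qed.

Lemma differentiable_pow f n v :
  differentiable f v -> differentiable (fun w => f w ^+ n.+1) v.
Proof.
by move=> df; rewrite -exprfctE; exact: differentiableX.
Qed.

(** Reduces a value of the differential to a one-variable derivative along the line through [v];
    every non-vanishing of a differential of j is obtained this way. *)
Lemma diff_line f v u (g : K -> K) (dg : K) : differentiable f v ->
  (forall t, f (t *: u + v) = g t) -> is_derive (0 : K) 1 g dg -> 'd f v u = dg.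
Proof.
move=> df e [_ <-]; rewrite -deriveE // /derive.
suff -> : (fun h : K => h^-1 *: ((f \o shift v) (h *: u) - f v)) =
          (fun h : K => h^-1 *: ((g \o shift 0) (h *: (1 : K)) - g 0)) by [].
apply/funext => t /=; rewrite e -[v in f v]add0r -(scale0r u) e.
by rewrite addr0 [_ *: 1]mulr1.
Qed.

Lemma diff_onto f v u : 'd f v u != 0 -> forall z : K, exists w, 'd f v w = z.
Proof. by move=> n0 z; exists ((z / 'd f v u) *: u); rewrite linearZ; exact: mulfVK. Qed.

(** By the product rule each term of the derivative of [g ^+ 2 * h] keeps a factor [g v], which is
    zero. The constant [c] will be 0 or 1728. *)
Lemma diff_double_zero f g h v (c : K) :
  differentiable g v -> differentiable h v -> g v = 0 ->
  (\near v, f v = c + g v ^+ 2 * h v) -> differentiable f v ->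
  forall u, 'd f v u = 0.
Proof.
move=> dg dh g0 e df u; rewrite (near_eq_diff e) //.
have -> : (fun w => c + g w ^+ 2 * h w) = cst c + g ^+ 2 * h by [].
have dgh : differentiable (g ^+ 2 * h) v.
  by apply: differentiableM => //; exact: differentiableX.
rewrite diffD // diff_cst diffM //; last exact: differentiableX.
by rewrite diffX // !fctE /= g0 expr1 expr0n /= mulr0 !scale0r scaler0 !addr0.
Qed.

End Differentials.

Ltac solve_diff :=
  lazymatch goal with
  | |- @differentiable_def _ _ _ ?f _ _ =>
    lazymatch f with
    | fun w => @?g w + @?h w =>
      refine (@differentiableD _ _ _ g h _ _ _); solve_diff
    | fun w => - @?g w => refine (@differentiableN _ _ _ g _ _); solve_diff
    | fun w => @?g w * @?h w =>
      refine (@differentiableM _ _ g h _ _ _); solve_diff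
    | fun w => @?g w ^+ _ => refine (@differentiable_pow _ _ g _ _ _); solve_diff
    | fun w => (@?g w)^-1 =>
      refine (@differentiableV _ _ g _ _ _); [solve_diff|by []]
    | _ => first [by [] | exact: differentiable_cst]
    end
  end.

(** * The j-invariant by coefficients and by roots *)

Section JFunction.
Context {R : realType}.
Local Notation C := (Cx R).

(** [j_num], [j_den] and [j_num1728] are the q, disc and S of the overview. *)
Definition j_num (a b : C) : C := a ^+ 2 - 3 * b.

Definition j_den (a b c : C) : C :=
  a ^+ 2 * b ^+ 2 - 4 * a ^+ 3 * c + 18 * a * b * c - 4 * b ^+ 3 - 27 * c ^+ 2.

Definition j_num1728 (a b c : C) : C := 2 * a ^+ 3 - 9 * a * b + 27 * c.

Lemma j_cubicE (a b c : C) : j_cubic a b c = 256 * j_num a b ^+ 3 / j_den a b c.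
Proof.
rewrite /j_cubic -mulrN -invrN; congr (_ / _); rewrite /j_den; ring.
Qed.

Lemma j_cubic1728E (a b c : C) : j_den a b c != 0 ->
  j_cubic a b c = 1728 + j_num1728 a b c ^+ 2 * (64 / j_den a b c).
Proof.
(* This is 64 times the classical identity 4 q^3 = 27 disc + S^2. *)
move=> d0; have e : 256 * j_num a b ^+ 3 =
    1728 * j_den a b c + j_num1728 a b c ^+ 2 * 64.
  rewrite /j_num /j_num1728 /j_den.
  ring.
rewrite j_cubicE e; move: (j_den a b c) d0 (1728 : C) (64 : C) => d d0 m n.
by rewrite mulrDl mulfK // mulrA.
Qed.

(** The coefficients have weights 1, 2, 3 in the roots, so q^3 and disc are both multiplied by
    [s ^+ 6]. *)
Lemma j_cubic_scale (a b c s : C) : s != 0 ->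
  j_cubic (s * a) (s ^+ 2 * b) (s ^+ 3 * c) = j_cubic a b c.
Proof.
move=> s0; rewrite !j_cubicE.
have -> : j_den (s * a) (s ^+ 2 * b) (s ^+ 3 * c) = s ^+ 6 * j_den a b c.
  by rewrite /j_den; ring.
have -> : j_num (s * a) (s ^+ 2 * b) = s ^+ 2 * j_num a b by rewrite /j_num; ring.
rewrite exprMn -exprM mulrCA -mulf_div divff ?mul1r //.
by rewrite expf_neq0.
Qed.

Section Composition.
Context {V : normedModType C}.
Variables (a b c : V -> C) (v : V).
Hypothesis da : differentiable a v.
Hypothesis db : differentiable b v.
Hypothesis dc : differentiable c v.
Let den w := j_den (a w) (b w) (c w).
Hypothesis den0 : den v != 0.

Lemma differentiable_j_den : differentiable den v.
Proof.
rewrite /den /j_den; solve_diff.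
Qed.

Let den_near0 : \near v, den v != 0.
Proof.
have /differentiable_continuous dd := differentiable_j_den.
exact: (cvgr_neq0 _ dd den0).
Qed.

Lemma differentiable_j_cubic : differentiable (fun w => j_cubic (a w) (b w) (c w)) v.
Proof.
rewrite (_ : (fun w => _) = fun w => 256 * j_num (a w) (b w) ^+ 3 / den w).
  by have dden := differentiable_j_den; rewrite /j_num; solve_diff.
by apply/funext => w; exact: j_cubicE.
Qed.

(** Write j as q^2 (256 q / disc), or as 1728 + S^2 (64 / disc), and apply [diff_double_zero]. The
    second form needs disc to be non-zero, so it is used only near [v]. *)
Lemma diff_j_cubic_critical :
  j_cubic (a v) (b v) (c v) = 0 \/ j_cubic (a v) (b v) (c v) = 1728 ->
  forall u, 'd (fun w => j_cubic (a w) (b w) (c w)) v u = 0.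
Proof.
have dden := differentiable_j_den.
case=> ej u.
- apply: (@diff_double_zero _ _ _ (fun w => j_num (a w) (b w))
    (fun w => 256 * j_num (a w) (b w) / den w) v 0); last first.
  + exact: differentiable_j_cubic.
  + near=> w; rewrite add0r j_cubicE; rewrite /den; set q := j_num _ _.
    by move: (256 : C) (j_den _ _ _)^-1 => n d; ring.
  + move/eqP: ej; rewrite j_cubicE mulf_eq0 invr_eq0 (negPf den0) orbF.
    by rewrite mulf_eq0 pnatr_eq0 /= expf_eq0 /= => /eqP.
  + by rewrite /j_num; solve_diff.
  + by rewrite /j_num; solve_diff.
- apply: (@diff_double_zero _ _ _ (fun w => j_num1728 (a w) (b w) (c w))
    (fun w => 64 / den w) v 1728); last first.
  + exact: differentiable_j_cubic.
  + by move: den_near0; apply: filter_app; near=> w => ?; rewrite j_cubic1728E.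
  + move: ej; rewrite j_cubic1728E // -[RHS]addr0 => /addrI /eqP.
    rewrite mulf_eq0 expf_eq0 /= => /orP[/eqP //|].
    by rewrite mulf_eq0 invr_eq0 (negPf den0) pnatr_eq0.
  + by solve_diff.
  + by rewrite /j_num1728; solve_diff.
Unshelve. all: by end_near. Qed.

End Composition.

Definition j_roots (l1 l2 l3 : C) : C :=
  j_cubic (- (l1 + l2 + l3)) (l1 * l2 + l1 * l3 + l2 * l3) (- (l1 * l2 * l3)).

Lemma j_den_roots (l1 l2 l3 : C) :
  j_den (- (l1 + l2 + l3)) (l1 * l2 + l1 * l3 + l2 * l3) (- (l1 * l2 * l3)) =
  ((l1 - l2) * (l2 - l3) * (l1 - l3)) ^+ 2.
Proof. rewrite /j_den; ring. Qed.

Lemma j_rootsE (l1 l2 l3 : C) : j_roots l1 l2 l3 =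
  256 * (l1 ^+ 2 - l1 * l2 - l1 * l3 + l2 ^+ 2 - l2 * l3 + l3 ^+ 2) ^+ 3 /
  ((l1 - l2) * (l2 - l3) * (l1 - l3)) ^+ 2.
Proof.
by rewrite /j_roots j_cubicE j_den_roots; congr (_ * _ ^+ 3 / _); rewrite /j_num; ring.
Qed.

Lemma j_roots_scale (s l1 l2 l3 : C) : s != 0 ->
  j_roots (s * l1) (s * l2) (s * l3) = j_roots l1 l2 l3.
Proof.
by move=> s0; rewrite -[RHS](j_cubic_scale _ _ _ s0); congr j_cubic; ring.
Qed.

Lemma j_roots_X (l1 l2 l3 : C) : l1 != l2 -> l2 != l3 -> l1 != l3 ->
  X_equation l1 l2 l3 -> j_roots l1 l2 l3 = 0 \/ j_roots l1 l2 l3 = 1728.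
Proof.
rewrite -subr_eq0 -(subr_eq0 l2) -(subr_eq0 l1 l3) => d1 d2 d3 /eqP.
rewrite /X_equation mulf_eq0 => /orP [|]; last first.
  rewrite expf_eq0 /= => /eqP e; left; rewrite j_rootsE e.
  by rewrite expr0n /= mulr0 mul0r.
move=> /eqP e; right.
rewrite /j_roots j_cubic1728E ?j_den_roots ?expf_neq0 ?mulf_neq0 //.
have -> : j_num1728 (- (l1 + l2 + l3)) (l1 * l2 + l1 * l3 + l2 * l3) (- (l1 * l2 * l3))
   = (-1) * ((l1 - 2 * l2 + l3) * (l1 + l2 - 2 * l3) * (2 * l1 - l2 - l3)).
  rewrite /j_num1728; ring.
by rewrite e mulr0 expr0n /= mul0r addr0.
Qed.

End JFunction.

Ltac solve_derive :=
  lazymatch goal with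
  | |- is_derive _ _ ?f _ =>
    lazymatch f with
    | cst _ => notypeclasses refine (is_derive_cst _ _ _)
    | id => notypeclasses refine (is_derive_id _ _)
    | (_ + _) => notypeclasses refine (is_deriveD _ _); solve_derive
    | (- _) => notypeclasses refine (is_deriveN _); solve_derive
    | (_ * _) => notypeclasses refine (is_deriveM _ _); solve_derive
    | (_ ^+ _) => notypeclasses refine (is_deriveX _ _); solve_derive
    | _ => eassumption
    end
  end.

(** * The derivative of j as a function of the roots *)

Section JDerivative.
Context {R : realType}.
Local Notation C := (Cx R).

Lemma is_deriveV (V : normedModType C) (f : V -> C) (v u : V) (df : C) :
  f v != 0 -> is_derive v u f df ->
  is_derive v u (fun w => (f w)^-1) (- f v ^- 2 * df).
Proof.
move=> f0 [fd <-]; apply: DeriveDef; first exact: derivableV.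
by rewrite deriveV.
Qed.

Lemma is_derive_affine (a b : C) : is_derive (0 : C) 1 (fun t => a + t * b) b.
Proof.
have -> : (fun t : C => a + t * b) = cst a + id * cst b by [].
notypeclasses refine (is_derive_eq _ _); [solve_derive|]; rewrite scaler0 add0r add0r.
exact: mulr1.
Qed.

(* In terms of r = (l3 - l1) / (l2 - l1), j = 256 (r^2 - r + 1)^3 / (r (r - 1))^2,
   whose derivative vanishes on r^2 - r + 1 = 0 and on (2 r - 1) (r - 2) (r + 1) = 0;
   these are the factors of [X_equation]. *)
Lemma is_derive_j_roots (V : normedModType C) (a b c : V -> C) (v u : V)
    (da db dc : C) :
  is_derive v u a da -> is_derive v u b db -> is_derive v u c dc ->
  a v != b v -> b v != c v -> a v != c v ->
  is_derive v u (fun w => j_roots (a w) (b w) (c w))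
    (256 * (a v ^+ 2 - a v * b v - a v * c v + b v ^+ 2 - b v * c v + c v ^+ 2) ^+ 2 *
     ((a v - 2 * b v + c v) * (a v + b v - 2 * c v) * (2 * a v - b v - c v)) *
     (da * (b v - c v) + db * (c v - a v) + dc * (a v - b v)) /
     ((a v - b v) * (b v - c v) * (a v - c v)) ^+ 3).
Proof.
move=> ha hb hc; rewrite -subr_eq0 -(subr_eq0 (b v)) -(subr_eq0 (a v) (c v)).
move=> ab bc ac.
pose q := a ^+ 2 - a * b - a * c + b ^+ 2 - b * c + c ^+ 2.
pose p := (a - b) * (b - c) * (a - c).
have -> : (fun w => j_roots (a w) (b w) (c w)) =
    cst 256 * q ^+ 3 * (fun w => ((p ^+ 2) w)^-1).
  by apply/funext => w; rewrite j_rootsE.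
have pv0 : p v != 0 by rewrite /p !mulf_neq0.
have hp : is_derive v u p ((da - db) * (b v - c v) * (a v - c v) +
    (a v - b v) * (db - dc) * (a v - c v) + (a v - b v) * (b v - c v) * (da - dc)).
  rewrite /p; notypeclasses refine (is_derive_eq _ _); [solve_derive|]; rewrite /GRing.scale /= ?fctE; ring.
have hq : is_derive v u q (2 * a v * da - a v * db - b v * da - a v * dc - c v * da
    + 2 * b v * db - b v * dc - c v * db + 2 * c v * dc).
  rewrite /q; notypeclasses refine (is_derive_eq _ _); [solve_derive|]; rewrite /GRing.scale /= ?fctE; ring.
have hV := is_deriveV (f := p ^+ 2) (expf_neq0 2 pv0) (is_deriveX 2 hp).
notypeclasses refine (is_derive_eq _ _); [solve_derive|].
rewrite /GRing.scale /= ?fctE.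
have -> : p v = (a v - b v) * (b v - c v) * (a v - c v) by [].
have -> : q v = a v ^+ 2 - a v * b v - a v * c v + b v ^+ 2 - b v * c v + c v ^+ 2 by [].
move: (a v) (b v) (c v) ab bc ac => x y z ab bc ac.
move: (256 : C) => n; field.
by rewrite ab bc ac.
Qed.

(** Up to sign, the last expression assumed non-zero is the determinant with rows (1, 1, 1), the
    roots, and their velocities. It vanishes exactly when the velocity comes from translating and
    scaling the roots, motions that preserve j. *)
Lemma diff_j_roots_neq0 (V : normedModType C) (f : V -> C) (v u : V)
    (a0 a1 b0 b1 c0 c1 : C) : differentiable f v ->
  (forall t, f (t *: u + v) = j_roots (a0 + t * a1) (b0 + t * b1) (c0 + t * c1)) ->
  a0 != b0 -> b0 != c0 -> a0 != c0 -> ~ X_equation a0 b0 c0 ->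
  a1 * (b0 - c0) + b1 * (c0 - a0) + c1 * (a0 - b0) != 0 -> 'd f v u != 0.
Proof.
move=> df e ab bc ac nX w0.
have ha := is_derive_affine a0 a1; have hb := is_derive_affine b0 b1.
have hc := is_derive_affine c0 c1.
have H := is_derive_j_roots ha hb hc.
move: H; rewrite !mul0r !addr0 => /(_ ab bc ac) H.
have p0 : (a0 - b0) * (b0 - c0) * (a0 - c0) != 0 by rewrite !mulf_neq0 ?subr_eq0.
move/eqP: nX; rewrite mulf_eq0 expf_eq0 negb_or => /andP[n1 n2].
have n0 : (256 : C) != 0 by rewrite pnatr_eq0.
rewrite (diff_line df e H).
by apply: mulf_neq0 (mulf_neq0 (mulf_neq0 (mulf_neq0 n0 (expf_neq0 2 n2)) n1) w0) _;
  rewrite invr_eq0 (expf_neq0 3 p0).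
Qed.

End JDerivative.

(** * Pencils of conics *)

Lemma det2 (S : comNzRingType) (M : 'M[S]_2) : \det M = M 0 0 * M 1 1 - M 0 1 * M 1 0.
Proof.
(* Entries are indexed by naturals so that the lifted ordinals of the cofactor expansion compute to
   numerals. *)
pose m a b := M (inord a) (inord b).
have mE i j : M i j = m (val i) (val j) by rewrite /m !inord_val.
rewrite (expand_det_row _ 0) !big_ord_recl big_ord0 /cofactor !det_mx11 !mxE !mE /=.
rewrite /bump /=; ring.
Qed.

Lemma det3 (S : comNzRingType) (M : 'M[S]_3) : \det M =
  M 0 0 * (M 1 1 * M 2%R 2%R - M 1 2%R * M 2%R 1)
  - M 0 1 * (M 1 0 * M 2%R 2%R - M 1 2%R * M 2%R 0)
  + M 0 2%R * (M 1 0 * M 2%R 1 - M 1 1 * M 2%R 0).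
Proof.
pose m a b := M (inord a) (inord b).
have mE i j : M i j = m (val i) (val j) by rewrite /m !inord_val.
rewrite (expand_det_row _ 0) !big_ord_recl big_ord0 /cofactor !det2 !mxE !mE /=.
rewrite /bump /=; ring.
Qed.

Section Pencils.
Context {R : realType}.
Local Notation C := (Cx R).
Implicit Types A B P : 'M[C]_3.

(* The derivative at 0 of [t |-> \det (A + t *: B)]. *)
Definition mixed_det A B : C :=
  B 0 0 * (A 1 1 * A 2%R 2%R - A 1 2%R * A 2%R 1)
  - B 0 1 * (A 1 0 * A 2%R 2%R - A 1 2%R * A 2%R 0)
  + B 0 2%R * (A 1 0 * A 2%R 1 - A 1 1 * A 2%R 0)
  + A 0 0 * (B 1 1 * A 2%R 2%R + A 1 1 * B 2%R 2%R - B 1 2%R * A 2%R 1 - A 1 2%R * B 2%R 1)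
  - A 0 1 * (B 1 0 * A 2%R 2%R + A 1 0 * B 2%R 2%R - B 1 2%R * A 2%R 0 - A 1 2%R * B 2%R 0)
  + A 0 2%R * (B 1 0 * A 2%R 1 + A 1 0 * B 2%R 1 - B 1 1 * A 2%R 0 - A 1 1 * B 2%R 0).

Lemma mixed_detZ (a b : C) A B :
  mixed_det (a *: A) (b *: B) = a ^+ 2 * b * mixed_det A B.
Proof. by rewrite /mixed_det !mxE; ring. Qed.

Lemma det_pencilE A B : det_pencil A B = (\det A)%:P * 'X^3 +
  (mixed_det A B)%:P * 'X^2 + (mixed_det B A)%:P * 'X + (\det B)%:P.
Proof. rewrite /det_pencil !det3 !mxE /mixed_det; ring. Qed.

Lemma coef_cubic (a b c d : C) k :
  (a%:P * 'X^3 + b%:P * 'X^2 + c%:P * 'X + d%:P)`_k = nth 0 [:: d; c; b; a] k.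
Proof.
rewrite !coefD !coefCM !coefXn coefX coefC.
by case: k => [|[|[|[|k]]]] /=; rewrite ?mulr0 ?mulr1 ?addr0 ?add0r ?nth_nil.
Qed.

Definition j_poly (p : {poly C}) : C :=
  j_cubic (p`_2 / p`_3) (p`_1 / p`_3) (p`_0 / p`_3).

Lemma j_polyZ (s : C) p : s != 0 -> j_poly (s *: p) = j_poly p.
Proof.
by move=> s0; rewrite /j_poly !coefZ -!mulf_div divff // !mul1r.
Qed.

Definition j_pencil A B : C := j_poly (det_pencil A B).

Lemma j_pencilE A B : j_pencil A B =
  j_cubic (mixed_det A B / \det A) (mixed_det B A / \det A) (\det B / \det A).
Proof.
by rewrite /j_pencil /j_poly det_pencilE !coef_cubic.
Qed.

(** The roots of the pencil are multiplied by [b / a], which j ignores; hence j may be computed from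
    any matrices representing the two conics. *)
Lemma j_pencilZ (a b : C) A B : a != 0 -> b != 0 ->
  j_pencil (a *: A) (b *: B) = j_pencil A B.
Proof.
move=> a0 b0; have s0 : b / a != 0 by rewrite mulf_neq0 ?invr_eq0.
rewrite !j_pencilE -[RHS](j_cubic_scale _ _ _ s0) !detZ.
rewrite !mixed_detZ !invfM.
move: (mixed_det _ _) (mixed_det _ _) (\det A)^-1 (\det B) => x y z t.
by congr j_cubic; field.
Qed.

Lemma j_poly_roots (s l1 l2 l3 : C) : s != 0 ->
  j_poly (s *: (('X - l1%:P) * ('X - l2%:P) * ('X - l3%:P))) = j_roots l1 l2 l3.
Proof.
move=> s0; rewrite j_polyZ //.
have -> : ('X - l1%:P) * ('X - l2%:P) * ('X - l3%:P) =
  1%:P * 'X^3 + (- (l1 + l2 + l3))%:P * 'X^2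
  + (l1 * l2 + l1 * l3 + l2 * l3)%:P * 'X + (- (l1 * l2 * l3))%:P by ring.
by rewrite /j_poly !coef_cubic /= !divr1.
Qed.

Lemma det_pencil_congr P A B : det_pencil (P *m A *m P^T) (P *m B *m P^T) =
  (\det P) ^+ 2 *: det_pencil A B.
Proof.
have -> : det_pencil (P *m A *m P^T) (P *m B *m P^T) = \det (map_mx polyC P *m
    ('X *: map_mx polyC A + map_mx polyC B) *m (map_mx polyC P)^T).
  by rewrite /det_pencil !map_mxM -!map_trmx mulmxDr mulmxDl -scalemxAr -scalemxAl.
rewrite !det_mulmx det_tr det_map_mx -mul_polyC /det_pencil; ring.
Qed.

(** The conic a xy + b xz + c yz = 0, up to a factor 2: the general conic through the three
    coordinate points. *)
Definition offdiag_mx (a b c : C) : 'M[C]_3 := \matrix_(i, j)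
  nth 0 (nth [::] [:: [:: 0; a; b]; [:: a; 0; c]; [:: b; c; 0]] i) j.

Lemma offdiag_mx_sym a b c : (offdiag_mx a b c)^T = offdiag_mx a b c.
Proof.
apply/matrixP => i j; rewrite !mxE.
by case: i => [[|[|[|//]]] hi]; case: j => [[|[|[|//]]] hj].
Qed.

Lemma det_offdiag a b c : \det (offdiag_mx a b c) = 2 * a * b * c.
Proof. rewrite det3 !mxE /=; ring. Qed.

(** A symmetric matrix with zero diagonal has as determinant twice the product of its three entries,
    so each entry of the pencil contributes one linear factor. *)
Lemma det_pencil_offdiag (a b c x y z : C) : a != 0 -> b != 0 -> c != 0 ->
  det_pencil (offdiag_mx a b c) (offdiag_mx x y z) = (2 * a * b * c) *:
   (('X - (- (x / a))%:P) * ('X - (- (y / b))%:P) * ('X - (- (z / c))%:P)).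
Proof.
move=> a0 b0 c0; rewrite det_pencilE !det_offdiag /mixed_det !mxE /= -mul_polyC.
have [ea eb ec] : [/\ x = a * (x / a), y = b * (y / b) & z = c * (z / c)].
  by split; rewrite mulrCA divff ?mulr1.
move: (x / a) (y / b) (z / c) ea eb ec => x' y' z' -> -> ->; ring.
Qed.

End Pencils.

(** * Normal form of a transverse pair *)

Section NormalForm.
Context {R : realType}.
Local Notation C := (Cx R).
Implicit Types (A B P : 'M[C]_3) (p q r v z : 'rV[C]_3).

Definition isotropic A p : Prop := p *m A *m p^T = 0.

Definition nonprop p q : Prop := ~ exists2 k : C, k != 0 & p = k *: q.

Lemma nonprop_free p q (a b : C) : p != 0 -> q != 0 -> nonprop p q ->
  a *: p + b *: q = 0 -> a = 0 /\ b = 0.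
Proof.
move=> p0 q0 npq e; have [a0|a0] := eqVneq a 0.
  split=> //; move/eqP: e; rewrite a0 scale0r add0r scaler_eq0 (negPf q0) orbF.
  by move/eqP.
have pE : p = (- (b / a)) *: q.
  apply: (scalerI a0); rewrite scalerA mulrN mulrCA divff // mulr1 scaleNr.
  by apply/eqP; rewrite -addr_eq0 e.
exfalso; apply: npq; exists (- (b / a)) => //.
by apply: contraNneq p0 => e0; rewrite pE e0 scale0r.
Qed.

Lemma row_mulC A p q : A^T = A -> p *m A *m q^T = q *m A *m p^T.
Proof.
move=> sA; have tr11 (M : 'M[C]_1) : M^T = M.
  by apply/matrixP => i j; rewrite mxE !ord1.
by rewrite -[LHS]tr11 !trmx_mul trmxK sA mulmxA.
Qed.

(** A line meets a non-degenerate conic in at most two points. If all three coefficients were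
    non-zero, evaluating the form at a p + b q = - c r would make [p] and [q] orthogonal; their span
    would be totally isotropic of dimension 2, and the rank bound would give 2 + 2 <= 3. *)
Lemma isotropic_free A p q r (a b c : C) : A^T = A -> A \in unitmx ->
  isotropic A p -> isotropic A q -> isotropic A r ->
  p != 0 -> q != 0 -> r != 0 -> nonprop p q -> nonprop p r -> nonprop q r ->
  a *: p + b *: q + c *: r = 0 -> [/\ a = 0, b = 0 & c = 0].
Proof.
move=> sA uA ip iq ir p0 q0 r0 npq npr nqr e.
have [c0|c0] := eqVneq c 0.
  move: e; rewrite c0 scale0r addr0.
  by case/(nonprop_free p0 q0 npq) => -> ->.
have [a0|a0] := eqVneq a 0.
  move: e; rewrite a0 scale0r add0r => /(nonprop_free q0 r0 nqr)[_ c00].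
  by rewrite c00 eqxx in c0.
have [b0|b0] := eqVneq b 0.
  move: e; rewrite b0 scale0r addr0 => /(nonprop_free p0 r0 npr)[_ c00].
  by rewrite c00 eqxx in c0.
have ipq : p *m A *m q^T = 0.
  have : (a *: p + b *: q) *m A *m (a *: p + b *: q)^T = 0.
    have -> : a *: p + b *: q = - c *: r.
      by apply/eqP; rewrite scaleNr -addr_eq0 e.
    by rewrite linearZ /= -!scalemxAl -scalemxAr ir !scaler0.
  have -> : (a *: p + b *: q)^T = a *: p^T + b *: q^T.
    by apply/matrixP => i j; rewrite !mxE.
  rewrite !mulmxDl !mulmxDr -!scalemxAl -!scalemxAr ip iq.
  rewrite (row_mulC q p sA) !scaler0 add0r addr0 !scalerA -scalerDl => /eqP.
  rewrite scaler_eq0 [b * a]mulrC -mulr2n mulrn_eq0 mulf_eq0 (negPf a0) (negPf b0).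
  by move/eqP.
pose K := col_mx p q.
have rK : row_free K.
  apply: inj_row_free => v; rewrite -(hsubmxK v) mul_row_col => e0.
  have [s sE] : exists s, lsubmx v = s%:M by exists (lsubmx v 0 0); exact: mx11_scalar.
  have [t tE] : exists t, rsubmx v = t%:M by exists (rsubmx v 0 0); exact: mx11_scalar.
  move: e0; rewrite sE tE !mul_scalar_mx => /(nonprop_free p0 q0 npq)[-> ->].
  by rewrite !raddf0 row_mx0.
have KAK : (K *m A) *m K^T = 0.
  rewrite tr_col_mx mul_col_mx mul_col_row ip iq ipq (row_mulC q p sA) ipq.
  by rewrite block_mx0.
have := mulmx0_rank_max KAK; rewrite mxrank_tr mxrankMfree ?row_free_unit //.
by move/eqP: rK => ->.
Qed.

Definition rows3 p q r : 'M[C]_3 := \matrix_(i < 3) nth 0 [:: p; q; r] i.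

Lemma mul_rows3 v p q r : v *m rows3 p q r = v 0 0 *: p + v 0 1 *: q + v 0 2%R *: r.
Proof.
apply/rowP => j; rewrite !mxE !big_ord_recl big_ord0 !mxE /= addr0 addrA.
by congr (v _ _ * _ + v _ _ * _ + v _ _ * _); apply/val_inj.
Qed.

Lemma rows3_unit p q r :
  (forall a b c : C, a *: p + b *: q + c *: r = 0 -> [/\ a = 0, b = 0 & c = 0]) ->
  rows3 p q r \in unitmx.
Proof.
move=> H; rewrite unitmxE unitfE; apply/det0P => -[v v0].
rewrite mul_rows3 => /H [e0 e1 e2]; case/eqP: v0; apply/rowP => i; rewrite mxE.
by case: i => [[|[|[|//]]] hi]; [rewrite -e0|rewrite -e1|rewrite -e2];
  congr (v _ _); apply/val_inj.
Qed.

Lemma ord3_forall (Q : 'I_3 -> Prop) : Q 0 -> Q 1 -> Q 2%R -> forall i, Q i.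
Proof.
move=> q0 q1 q2 [[|[|[|//]]] hi];
  [move: q0|move: q1|move: q2]; congr Q; exact/val_inj.
Qed.

(** The first three points form a basis. A zero coordinate of the fourth would be a dependence among
    three of the points, so its coordinates can be absorbed into the basis vectors, and the fourth
    point becomes (1, 1, 1). *)
Lemma four_points_frame A (p : 'I_4 -> 'rV[C]_3) : A^T = A -> A \in unitmx ->
  (forall i, isotropic A (p i)) -> (forall i, p i != 0) ->
  (forall i j, i != j -> nonprop (p i) (p j)) ->
  exists P, [/\ P \in unitmx, const_mx 1 *m P = p 3%R &
    forall i : 'I_3, exists2 k : C, k != 0 & row i P = k *: p (widen_ord (leqnSn 3) i)].
Proof.
move=> sA uA iA n0 np.
have fr i j k : i != j -> i != k -> j != k -> forall a b c : C,
    a *: p i + b *: p j + c *: p k = 0 -> [/\ a = 0, b = 0 & c = 0].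
  by move=> ij ik jk a b c; apply: (isotropic_free sA uA) => //; exact: np.
have uM := rows3_unit (fr 0 1 2%R erefl erefl erefl).
pose y := p 3%R *m invmx (rows3 (p 0) (p 1) (p 2%R)).
have yE : p 3%R = y 0 0 *: p 0 + y 0 1 *: p 1 + y 0 2%R *: p 2%R.
  by rewrite -mul_rows3 mulmxKV.
clearbody y.
have y0 : y 0 0 != 0.
  apply/eqP => e; have : y 0 1 *: p 1 + y 0 2%R *: p 2%R + (-1) *: p 3%R = 0.
    by rewrite [in p 3%R]yE e scale0r add0r scaleN1r subrr.
  by case/fr => // _ _ /eqP; rewrite oppr_eq0 oner_eq0.
have y1 : y 0 1 != 0.
  apply/eqP => e; have : y 0 0 *: p 0 + y 0 2%R *: p 2%R + (-1) *: p 3%R = 0.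
    by rewrite [in p 3%R]yE e scale0r addr0 scaleN1r subrr.
  by case/fr => // _ _ /eqP; rewrite oppr_eq0 oner_eq0.
have y2 : y 0 2%R != 0.
  apply/eqP => e; have : y 0 0 *: p 0 + y 0 1 *: p 1 + (-1) *: p 3%R = 0.
    by rewrite [in p 3%R]yE e scale0r addr0 scaleN1r subrr.
  by case/fr => // _ _ /eqP; rewrite oppr_eq0 oner_eq0.
exists (rows3 (y 0 0 *: p 0) (y 0 1 *: p 1) (y 0 2%R *: p 2%R)); split.
- apply: rows3_unit => a b c; rewrite !scalerA => /(fr 0 1 2%R erefl erefl erefl).
  move=> [/eqP e0 /eqP e1 /eqP e2]; move: e0 e1 e2.
  rewrite !mulf_eq0 (negPf y0) (negPf y1) (negPf y2) !orbF.
  by move=> /eqP -> /eqP -> /eqP ->.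
- by rewrite mul_rows3 !mxE !scale1r.
- apply: ord3_forall; [exists (y 0 0)|exists (y 0 1)|exists (y 0 2%R)] => //;
    by rewrite rowK /=; congr (_ *: p _); apply/val_inj.
Qed.

Lemma isotropic_congr P A z : isotropic A (z *m P) <-> isotropic (P *m A *m P^T) z.
Proof. by rewrite /isotropic trmx_mul !mulmxA. Qed.

Lemma isotropicE A z : isotropic A z <->
  \sum_(i < 3) \sum_(j < 3) z 0 i * A i j * z 0 j = 0.
Proof.
have -> : \sum_(i < 3) \sum_(j < 3) z 0 i * A i j * z 0 j = (z *m A *m z^T) 0 0.
  rewrite !mxE exchange_big /=; apply: eq_bigr => j _; rewrite !mxE mulr_suml.
  by apply: eq_bigr.
split=> [->|e]; first by rewrite mxE.
by apply/matrixP => i j; rewrite !ord1 e mxE.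
Qed.

Lemma isotropic_offdiag (a b c : C) z : isotropic (offdiag_mx a b c) z <->
  a * z 0 0 * z 0 1 + b * z 0 0 * z 0 2%R + c * z 0 1 * z 0 2%R = 0.
Proof.
pose m i := z 0 (inord i).
have mE i : z 0 i = m (val i) by rewrite /m !inord_val.
rewrite isotropicE !big_ord_recl !big_ord0 !mxE !mE /= /bump /=.
set u := a * _ * _ + _ + _; set w := (X in X = 0 <-> _).
have -> : w = 2 * u by rewrite /w /u; ring.
split=> [/eqP|->]; last by rewrite mulr0.
by rewrite mulf_eq0 pnatr_eq0 /= => /eqP.
Qed.

(** Passing through the coordinate points kills the diagonal; passing through [1 : 1 : 1] makes the
    remaining entries sum to zero. *)
Lemma congr_offdiag P A : A^T = A -> (forall i, isotropic A (row i P)) ->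
  isotropic A (const_mx 1 *m P) ->
  exists a b, P *m A *m P^T = offdiag_mx a b (- (a + b)).
Proof.
move=> sA iP /isotropic_congr; set E := P *m A *m P^T => i1.
have sE : E^T = E by rewrite /E !trmx_mul trmxK sA mulmxA.
have sEe i j : E i j = E j i by rewrite -[in LHS]sE mxE.
have dE i : E i i = 0.
  have := iP i; rewrite rowE => /isotropic_congr; rewrite -/E /isotropic.
  by rewrite -rowE trmx_delta -colE => /matrixP /(_ 0 0); rewrite !mxE.
have EO : E = offdiag_mx (E 0 1) (E 0 2%R) (E 1 2%R).
  apply/matrixP; apply: ord3_forall; apply: ord3_forall;
    by rewrite [RHS]mxE /= ?dE // sEe.
clearbody E; move: i1; rewrite [in isotropic E]EO => /isotropic_offdiag; rewrite !mxE !mulr1 => e.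
by exists (E 0 1), (E 0 2%R); rewrite {1}EO; congr offdiag_mx; apply/eqP; rewrite -addr_eq0 addrC e.
Qed.

(** With last two coordinates 1 and s, the equation of the conic is linear in the first one. Since s
    is neither 0 nor 1, the solution is neither a coordinate point nor [1 : 1 : 1]. *)
Lemma fifth_point P (a b c : C) : P \in unitmx -> b != 0 -> exists z,
  [/\ z != 0, isotropic (offdiag_mx a b c) z,
  forall i, nonprop (z *m P) (row i P) & nonprop (z *m P) (const_mx 1 *m P)].
Proof.
move=> uP b0.
(* As [b] is non-zero, 2 and 3 cannot both be roots of a + b s. *)
have [s [s0 s1 ab]] : exists s : C, [/\ s != 0, s != 1 & a + b * s != 0].
  have [e|n] := eqVneq (a + b * 2) 0; last first.
    by exists 2; rewrite pnatr_eq0 -subr_eq0 (_ : 2 - 1 = 1) ?oner_eq0 //; ring.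
  exists 3; split; first by rewrite pnatr_eq0.
    by rewrite -subr_eq0 (_ : 3 - 1 = 2) ?pnatr_eq0 //; ring.
  have -> : a + b * 3 = (a + b * 2) + b by ring.
  by rewrite e add0r.
pose z : 'rV[C]_3 := \row_i nth 0 [:: - (c * s) / (a + b * s); 1; s] i.
have zP w : nonprop z w -> nonprop (z *m P) (w *m P).
  move=> nz [k k0 e]; apply: nz; exists k => //.
  by rewrite -[z](mulmxK uP) e -scalemxAl mulmxK.
exists z; split.
- by apply/eqP => /rowP /(_ 1); rewrite !mxE /= => /eqP; rewrite oner_eq0.
- apply/isotropic_offdiag; rewrite !mxE /=; field; exact: ab.
- move=> i; rewrite rowE; apply: zP => -[k k0 /rowP e].
  have := e 1; have := e 2%R; rewrite !mxE /=; move: i {e}.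
  apply: ord3_forall => /=; rewrite ?mulr0 ?mulr1.
  + by move/eqP; rewrite (negPf s0).
  + by move/eqP; rewrite (negPf s0).
  + by move=> _ /eqP; rewrite oner_eq0.
- apply: zP => -[k k0 /rowP e].
  have e1 := e 1; have e2 := e 2%R; move: s1.
  by rewrite !mxE /= !mulr1 in e1 e2; rewrite e2 -e1 eqxx.
Qed.

Lemma on_conic_pt (c : CP R 5) p : p != 0 ->
  on_conic c (pt p) <-> isotropic (conic_mx c) p.
Proof.
move=> p0; have [a a0 e] := hc_pt p0.
rewrite /on_conic /isotropic e linearZ /= -!scalemxAl -scalemxAr scalerA.
split=> [/eqP|->]; last by rewrite scaler0.
by rewrite scaler_eq0 mulf_eq0 (negPf a0) => /eqP.
Qed.

Lemma transverse_frame (c d : CP R 5) : Opairs (c, d) -> exists P a b a' b',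
  [/\ P \in unitmx, P *m conic_mx c *m P^T = offdiag_mx a b (- (a + b)),
    P *m conic_mx d *m P^T = offdiag_mx a' b' (- (a' + b')) & a * b' != b * a'].
Proof.
rewrite /Opairs /= /Defs.nondegenerate /transverse; set S := [set p | _] => -[nc nd].
move=> /card_set_bijP[f [fS finj fsurj]].
have sA : (conic_mx c)^T = conic_mx c by exact: sym_mx_sym.
have sB : (conic_mx d)^T = conic_mx d by exact: sym_mx_sym.
have uA : conic_mx c \in unitmx by rewrite unitmxE unitfE.
(* [s] enumerates the four common points, as a section of the bijection [f]. *)
have /choice[s sP] (i : 'I_4) : exists s, S s /\ f s = i.
  by have [s ? ?] := fsurj i (ltn_ord i); exists s.
have iA i : isotropic (conic_mx c) (hc (s i)) by have [[]] := sP i.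
have iB i : isotropic (conic_mx d) (hc (s i)) by have [[]] := sP i.
have npS (i j : 'I_4) : i != j -> nonprop (hc (s i)) (hc (s j)).
  move=> /negP ij e; apply: ij; apply/eqP/val_inj => /=.
  rewrite -(sP i).2 -(sP j).2 -[s i]hcK -[s j]hcK; congr f.
  by apply/pt_eqP => //; exact: hc_neq0.
have [P [uP P3 Prow]] := four_points_frame sA uA iA (fun i => hc_neq0 _) npS.
have isoP A : (forall i, isotropic A (hc (s i))) -> forall i, isotropic A (row i P).
  move=> iso i; have [k k0 ->] := Prow i.
  by rewrite /isotropic linearZ /= -!scalemxAl -scalemxAr iso !scaler0.
have [a [b Aab]] : exists a b, P *m conic_mx c *m P^T = offdiag_mx a b (- (a + b)).
  by apply: congr_offdiag => //; [exact: isoP|rewrite P3].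
have [a' [b' Bab]] : exists a b, P *m conic_mx d *m P^T = offdiag_mx a b (- (a + b)).
  by apply: congr_offdiag => //; [exact: isoP|rewrite P3].
(* If [a * b' = b * a'], the two normal forms are proportional, and the extra point given by
   [fifth_point] on the first conic lies on the second too. *)
exists P, a, b, a', b'; split=> //; apply/eqP => ab.
have : \det (P *m conic_mx c *m P^T) != 0.
  by rewrite !det_mulmx det_tr !mulf_neq0 //; rewrite unitmxE unitfE in uP.
rewrite Aab det_offdiag !mulf_eq0 !negb_or => /andP[/andP[/andP[_ a0] b0] _].
have [z [z0 iz nz nz1]] := fifth_point a (- (a + b)) uP b0.
have zP0 : z *m P != 0.
  by apply: contraNneq z0 => e; rewrite -[z](mulmxK uP) e mul0mx.
have zS : S (pt (z *m P)).
  split; apply/on_conic_pt => //; apply/isotropic_congr; first by rewrite Aab.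
  rewrite Bab; apply/isotropic_offdiag; move/isotropic_offdiag: iz => iz.
  apply: (mulfI a0); rewrite mulr0; transitivity (a' * 0 : C); last by rewrite mulr0.
  rewrite -iz; apply/eqP; rewrite -subr_eq0; apply/eqP.
  transitivity ((a * b' - b * a') * (z 0 0 * z 0 2%R - z 0 1 * z 0 2%R)); first by ring.
  by rewrite ab subrr mul0r.
(* The extra point must be one of the four: index 3 is excluded by [nz1], the others by [nz]. *)
have fz := fS _ zS; pose i := Ordinal fz.
have zi : pt (z *m P) = s i.
  by apply: finj; rewrite ?inE //; [exact: (sP i).1|rewrite (sP i).2].
have {zi} [k k0 zi] : exists2 k : C, k != 0 & z *m P = k *: hc (s i).
  by apply/pt_eqP; rewrite ?hc_neq0 ?hcK.
have [i3|i3] := ltnP i 3; last first.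
  apply: nz1; exists k => //; rewrite P3 zi; congr (_ *: hc (s _)); apply/val_inj.
  by move: (ltn_ord i) i3 => /=; case: (f _) => [|[|[|[|]]]].
have [l l0 e] := Prow (Ordinal i3).
apply: (nz (Ordinal i3)); exists (k / l); first by rewrite mulf_neq0 ?invr_eq0.
rewrite e scalerA divfK // zi; congr (_ *: hc (s _)); exact/val_inj.
Qed.

End NormalForm.

(** * Roots of the pencil up to scaling and permutation *)

Lemma big_ord3 (T : Type) (idx : T) (op : Monoid.law idx) (F : 'I_3 -> T) :
  \big[op/idx]_(i < 3) F i = op (op (F 0) (F 1)) (F 2%R).
Proof.
rewrite !big_ord_recl big_ord0 Monoid.mulm1 Monoid.mulmA.
by congr (op (op (F _) (F _)) (F _)); apply/val_inj.
Qed.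

Section Roots.
Context {R : realType}.
Local Notation C := (Cx R).

Definition row3 (a b c : C) : 'rV[C]_3 := \row_(i < 3) [:: a; b; c]`_i.

(** Homogeneous coordinates of a point of U. *)
Definition admissible (v : 'rV[C]_3) : Prop :=
  (forall i, v 0 i != 0) /\ injective (v 0).

Definition j_row (v : 'rV[C]_3) : C := j_roots (v 0 0) (v 0 1) (v 0 2%R).

Lemma row3E (v : 'rV[C]_3) : v = row3 (v 0 0) (v 0 1) (v 0 2%R).
Proof.
by apply/rowP; apply: ord3_forall; rewrite mxE.
Qed.

Lemma admissible_row3 (a b c : C) : a != 0 -> b != 0 -> c != 0 ->
  a != b -> b != c -> a != c -> admissible (row3 a b c).
Proof.
move=> a0 b0 c0 ab bc ac; split; first by apply: ord3_forall; rewrite mxE.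
apply: ord3_forall; apply: ord3_forall; rewrite !mxE //= => /eqP;
  by rewrite ?(negPf ab) ?(negPf bc) ?(negPf ac) // eq_sym
     ?(negPf ab) ?(negPf bc) ?(negPf ac).
Qed.

Lemma admissible_neq v : admissible v ->
  [/\ v 0 0 != v 0 1, v 0 1 != v 0 2%R & v 0 0 != v 0 2%R].
Proof. by move=> [_ inj]; split; rewrite (inj_eq inj). Qed.

Lemma admissible_neq0 v : admissible v -> v != 0.
Proof. by move=> [v0 _]; apply: contraNneq (v0 0) => ->; rewrite mxE. Qed.

Lemma admissible_perm (s : 'S_3) (k : C) v : k != 0 -> admissible v ->
  admissible (k *: col_perm s v).
Proof.
move=> k0 [v0 vi]; split=> [i|i j]; first by rewrite !mxE mulf_neq0.
by rewrite !mxE => /(mulfI k0)/vi/perm_inj.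
Qed.

(** Power sums replace the elementary symmetric functions, so that invariance under permutations
    becomes a reindexing. *)
Lemma j_row_sums (v : 'rV[C]_3) (p := fun n : nat => \sum_i v 0 i ^+ n) : j_row v =
  j_cubic (- p 1%N) ((p 1%N ^+ 2 - p 2%N) / 2) (- \prod_i v 0 i).
Proof.
have n2 : (2 : C) != 0 by rewrite pnatr_eq0.
rewrite /p !big_ord3 /= /j_row /j_roots !expr1.
by congr j_cubic; field.
Qed.

Lemma j_row_perm (s : 'S_3) (k : C) v : k != 0 ->
  j_row (k *: col_perm s v) = j_row v.
Proof.
move=> k0; rewrite /j_row !mxE j_roots_scale //.
transitivity (j_row (col_perm s v)); first by rewrite /j_row !mxE.
rewrite -/(j_row v) !j_row_sums /=.
have S n : \sum_i col_perm s v 0 i ^+ n = \sum_i v 0 i ^+ n.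
  by rewrite [RHS](reindex_inj (@perm_inj _ s)); apply: eq_bigr => i _; rewrite mxE.
have -> : \prod_i col_perm s v 0 i = \prod_i v 0 i.
  by rewrite [RHS](reindex_inj (@perm_inj _ s)); apply: eq_bigr => i _; rewrite mxE.
by rewrite !S.
Qed.

Lemma piS3_eqP (u v : 'rV[C]_3) : u != 0 -> v != 0 ->
  piS3 (pt u) = piS3 (pt v) <-> exists2 k : C, k != 0 & exists s, u = k *: col_perm s v.
Proof.
move=> u0 v0; have [a a0 e] := hc_pt v0.
have n0 s : col_perm s (hc (pt v)) != 0 by apply: col_perm_neq0; exact: hc_neq0.
have cE s : col_perm s (hc (pt v)) = a *: col_perm s v.
  by rewrite e; apply/rowP => i; rewrite !mxE.
split.
  move=> /eqmodP /asboolP[s] /(pt_eqP u0 (n0 s))[k k0 ->].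
  by exists (k * a); [rewrite mulf_neq0|exists s; rewrite cE scalerA].
move=> [k k0 [s us]]; apply/eqmodP/asboolP; exists s; apply/pt_eqP => //.
by exists (k / a); [rewrite mulf_neq0 ?invr_eq0|rewrite us cE scalerA divfK].
Qed.

Definition splits_at (A B : 'M[C]_3) (v : 'rV[C]_3) : Prop :=
  exists2 k : C, k != 0 & det_pencil A B =
    k *: (('X - (v 0 0)%:P) * ('X - (v 0 1)%:P) * ('X - (v 0 2%R)%:P)).

Lemma j_pencil_splits A B v : splits_at A B v -> j_pencil A B = j_row v.
Proof. by move=> [k k0 e]; rewrite /j_pencil e j_poly_roots. Qed.

Lemma splits_at_coefs A B v : splits_at A B v -> exists2 k : C, k != 0 &
  [/\ \det A = k, mixed_det A B = k * - (v 0 0 + v 0 1 + v 0 2%R),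
    mixed_det B A = k * (v 0 0 * v 0 1 + v 0 0 * v 0 2%R + v 0 1 * v 0 2%R) &
    \det B = k * - (v 0 0 * v 0 1 * v 0 2%R)].
Proof.
move=> [k k0]; move: (v 0 0) (v 0 1) (v 0 2%R) => x y z e; exists k => //.
have exp : k *: (('X - x%:P) * ('X - y%:P) * ('X - z%:P)) = k%:P * 'X^3 +
   (k * - (x + y + z))%:P * 'X^2 + (k * (x * y + x * z + y * z))%:P * 'X
   + (k * - (x * y * z))%:P by rewrite -mul_polyC; ring.
move: e; rewrite exp det_pencilE => e.
have c i := congr1 (fun p : {poly C} => p`_i) e.
by move: (c 3%N) (c 2%N) (c 1%N) (c 0%N); rewrite !coef_cubic.
Qed.

Lemma splits_at_scale (a b : C) A B v : a != 0 -> splits_at A B v ->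
  splits_at (a *: A) (b *: B) ((b / a) *: v).
Proof.
move=> a0 /splits_at_coefs[k k0 [e3 e2 e1 e0]].
exists (k * a ^+ 3); first by rewrite mulf_neq0 ?expf_neq0.
rewrite det_pencilE !detZ e3 e0 !mixed_detZ e1 e2 -mul_polyC !mxE.
have [t ->] : exists t, b = t * a by exists (b / a); rewrite divfK.
rewrite mulfK //; ring.
Qed.

Lemma splits_at_congr P A B v : P \in unitmx -> splits_at A B v ->
  splits_at (P *m A *m P^T) (P *m B *m P^T) v.
Proof.
move=> uP [k k0 e]; exists (\det P ^+ 2 * k).
  by rewrite mulf_neq0 // expf_neq0 // -unitfE -unitmxE.
by rewrite det_pencil_congr e scalerA.
Qed.

(** [root_class] involves a chosen pair in the orbit, chosen matrices and a chosen list of roots.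
    Congruence keeps the roots, rescaling the matrices multiplies them by a common factor, and
    unique factorization leaves only a permutation; the class in CP^2/S_3 sees none of this. *)
Lemma root_classE (x : Omega R) v : v != 0 ->
  splits_at (conic_mx (val x).1) (conic_mx (val x).2) v ->
  root_class (piM x) = piS3 (pt v).
Proof.
move=> v0 sv; pose y := repr (piM x).
pose p := det_pencil (conic_mx (val y).1) (conic_mx (val y).2).
rewrite -[root_class _]/(piS3 (pt (\row_(i < 3) (poly_roots p)`_i))).
have : same_orbit x y by apply/eqmodP; rewrite /y /piM reprK.
move=> /asboolP[P uP yE].
have [a a0 ea] := congr_conic_mx (val x).1 uP.
have [b b0 eb] := congr_conic_mx (val x).2 uP.
have pE' : p = det_pencil (a *: (P^T *m conic_mx (val x).1 *m P))
    (b *: (P^T *m conic_mx (val x).2 *m P)) by rewrite -ea -eb /p yE.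
have uPT : P^T \in unitmx by rewrite unitmx_tr.
have := splits_at_congr uPT sv; rewrite trmxK => /(splits_at_scale b a0).
rewrite /splits_at -pE' => -[k k0 pE]; clear pE'; clearbody p.
pose t := [tuple ((b / a) *: v) 0 i | i < 3].
have tE : ('X - (((b / a) *: v) 0 0)%:P) * ('X - (((b / a) *: v) 0 1)%:P) *
    ('X - (((b / a) *: v) 0 2%R)%:P) = \prod_(z <- t) ('X - z%:P).
  by rewrite big_tuple big_ord3 !tnth_mktuple.
have rE : p = lead_coef p *: \prod_(z <- poly_roots p) ('X - z%:P).
  by rewrite /poly_roots; case: closed_field_poly_normal.
have lk : lead_coef p = k.
  by rewrite pE tE lead_coefZ lead_coef_prod_XsubC mulr1.
move: rE; rewrite {1}pE tE lk => /(scalerI k0)/prod_XsubC_eq.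
rewrite perm_sym => /tuple_permP[s rs].
have rowE : \row_(i < 3) (poly_roots p)`_i = (b / a) *: col_perm s v.
  apply/rowP => i; rewrite !mxE rs -tnth_nth !tnth_mktuple.
  by rewrite !mxE.
have ba0 : b / a != 0 by rewrite mulf_neq0 ?invr_eq0.
rewrite rowE; apply/piS3_eqP => //; last by exists (b / a) => //; exists s.
by rewrite scaler_eq0 negb_or ba0 col_perm_neq0.
Qed.

Lemma root_class_scaled (x : Omega R) (a b : C) A B v : a != 0 -> b != 0 -> v != 0 ->
  conic_mx (val x).1 = a *: A -> conic_mx (val x).2 = b *: B -> splits_at A B v ->
  root_class (piM x) = piS3 (pt v).
Proof.
move=> a0 b0 v0 eA eB sv; have ba0 : b / a != 0 by rewrite mulf_neq0 ?invr_eq0.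
have nv : (b / a) *: v != 0 by rewrite scaler_eq0 negb_or ba0.
have -> : piS3 (pt v) = piS3 (pt ((b / a) *: v)).
  congr piS3; apply/pt_eqP => //.
  by exists (b / a)^-1; rewrite ?invr_eq0 // scalerA mulVf // scale1r.
by apply: root_classE => //; rewrite eA eB; exact: splits_at_scale.
Qed.

End Roots.

(** * Perturbation and existence of pairs *)

Section Existence.
Context {R : realType}.
Local Notation C := (Cx R).
Implicit Types (A B P : 'M[C]_3).

Lemma offdiagZ (k a b c : C) :
  k *: offdiag_mx a b c = offdiag_mx (k * a) (k * b) (k * c).
Proof.
by apply/matrixP; apply: ord3_forall; apply: ord3_forall; rewrite !mxE /= ?mulr0.
Qed.

Lemma offdiagD (a b c x y z : C) :
  offdiag_mx a b c + offdiag_mx x y z = offdiag_mx (a + x) (b + y) (c + z).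
Proof.
by apply/matrixP; apply: ord3_forall; apply: ord3_forall; rewrite !mxE /= ?addr0.
Qed.

Lemma splits_at_offdiag (a b c x y z : C) : a != 0 -> b != 0 -> c != 0 ->
  splits_at (offdiag_mx a b c) (offdiag_mx x y z)
    (row3 (- (x / a)) (- (y / b)) (- (z / c))).
Proof.
move=> a0 b0 c0; exists (2 * a * b * c); first by rewrite !mulf_neq0 ?pnatr_eq0.
by rewrite det_pencil_offdiag // !mxE.
Qed.

Lemma j_pencil_congr P A B : P \in unitmx ->
  j_pencil (P *m A *m P^T) (P *m B *m P^T) = j_pencil A B.
Proof.
move=> uP; rewrite /j_pencil det_pencil_congr j_polyZ //.
by rewrite expf_neq0 // -unitfE -unitmxE.
Qed.

(** [E] changes one off-diagonal entry of the second matrix in normal form, which moves only the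
    first root. The factor [s] absorbs the renormalization needed to follow this line in an affine
    chart. *)
Lemma pencil_perturbation (x : Omega R) A B (a b : C) : a != 0 -> b != 0 ->
  conic_mx (val x).1 = a *: A -> conic_mx (val x).2 = b *: B ->
  exists v E e, [/\ admissible v, splits_at A B v, E^T = E, e != 0 &
    forall s t, j_pencil A (s *: B + t *: E) =
      j_row (row3 (s * v 0 0 + t * e) (s * v 0 1) (s * v 0 2%R))].
Proof.
move=> a0 b0 eA eB; have : Opairs ((val x).1, (val x).2).
  by have := valP x; rewrite inE; case: (val x).
move=> xO; have [n1 n2 _] := xO.
have [P [c1 [c2 [d1 [d2 [uP]]]]]] := transverse_frame xO.
move: n1 n2; rewrite /Defs.nondegenerate /= eA eB => n1 n2.
rewrite -!scalemxAr -!scalemxAl => fA fB ncd.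
have {}fA : P *m A *m P^T =
    offdiag_mx (a^-1 * c1) (a^-1 * c2) (a^-1 * - (c1 + c2)).
  by rewrite -offdiagZ -fA scalerA mulVf // scale1r.
have {}fB : P *m B *m P^T =
    offdiag_mx (b^-1 * d1) (b^-1 * d2) (b^-1 * - (d1 + d2)).
  by rewrite -offdiagZ -fB scalerA mulVf // scale1r.
have dP0 : \det P != 0 by rewrite -unitfE -unitmxE.
have nz M k (u v w : C) : \det (k *: M) != 0 -> P *m M *m P^T = offdiag_mx u v w ->
    [/\ u != 0, v != 0 & w != 0].
  rewrite detZ mulf_eq0 negb_or => /andP[_ M0] e.
  have : \det (P *m M *m P^T) != 0 by rewrite !det_mulmx det_tr !mulf_neq0.
  rewrite e det_offdiag !mulf_eq0 !negb_or.
  by move=> /andP[/andP[/andP[_ -> ->] ->]].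
have [c1n c2n c3n] := nz _ _ _ _ _ n1 fA.
have [d1n d2n d3n] := nz _ _ _ _ _ n2 fB.
have {}ncd : (a^-1 * c1) * (b^-1 * d2) - (a^-1 * c2) * (b^-1 * d1) != 0.
  rewrite (_ : _ - _ = (a^-1 * b^-1) * (c1 * d2 - c2 * d1)); last by ring.
  by rewrite !mulf_neq0 ?invr_eq0 ?subr_eq0.
have sc : a^-1 * c1 + a^-1 * c2 + a^-1 * - (c1 + c2) = 0 by ring.
have sd : b^-1 * d1 + b^-1 * d2 + b^-1 * - (d1 + d2) = 0 by ring.
move: (a^-1 * c1) (a^-1 * c2) (a^-1 * - (c1 + c2)) (b^-1 * d1) (b^-1 * d2)
  (b^-1 * - (d1 + d2)) fA fB c1n c2n c3n d1n d2n d3n ncd sc sd.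
clear - uP => x1 x2 x3 y1 y2 y3 fA fB x10 x20 x30 y10 y20 y30 nxy sx sy.
pose E := invmx P *m offdiag_mx 1 0 0 *m (invmx P)^T.
have PE : P *m E *m P^T = offdiag_mx 1 0 0.
  by rewrite /E !mulmxA mulmxV // mul1mx -mulmxA -trmx_mul mulmxV // trmx1 mulmx1.
exists (row3 (- (y1 / x1)) (- (y2 / x2)) (- (y3 / x3))), E, (- x1^-1); split.
(* Two roots differ when the corresponding 2 by 2 minor of the entries is non-zero. As both triples
   sum to zero, the three minors agree up to sign. *)
- have nq (p q r s : C) : p != 0 -> q != 0 -> p * s - q * r != 0 ->
      - (r / p) != - (s / q).
    move=> p0 q0; apply: contraNneq => /oppr_inj e.
    have -> : r = s / q * p by rewrite -e divfK.
    by apply/eqP; field.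
  apply: admissible_row3; rewrite ?oppr_eq0 ?mulf_neq0 ?invr_eq0 //; apply: nq => //.
  + rewrite (_ : _ - _ = x1 * y2 - x2 * y1) //.
    have -> : x3 = - (x1 + x2) by apply/eqP; rewrite -addr_eq0 addrC sx.
    have -> : y3 = - (y1 + y2) by apply/eqP; rewrite -addr_eq0 addrC sy.
    ring.
  + rewrite (_ : _ - _ = - (x1 * y2 - x2 * y1)) ?oppr_eq0 //.
    have -> : x3 = - (x1 + x2) by apply/eqP; rewrite -addr_eq0 addrC sx.
    have -> : y3 = - (y1 + y2) by apply/eqP; rewrite -addr_eq0 addrC sy.
    ring.
- have uP' : invmx P \in unitmx by rewrite unitmx_inv.
  have inv M : invmx P *m (P *m M *m P^T) *m (invmx P)^T = M.
    by rewrite !mulmxA mulVmx // mul1mx -mulmxA -trmx_mul mulVmx // trmx1 mulmx1.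
  have iA := inv A; have iB := inv B; rewrite fA in iA; rewrite fB in iB.
  have := splits_at_congr uP' (splits_at_offdiag y1 y2 y3 x10 x20 x30).
  by rewrite iA iB.
- by rewrite /E !trmx_mul trmxK offdiag_mx_sym mulmxA.
- by rewrite oppr_eq0 invr_eq0.
- move=> s t; rewrite -(j_pencil_congr _ _ uP) fA mulmxDr mulmxDl.
  rewrite -!scalemxAr -!scalemxAl fB PE !offdiagZ offdiagD !mulr0 !addr0 mulr1.
  rewrite (j_pencil_splits (splits_at_offdiag _ _ _ x10 x20 x30)).
  by congr j_row; congr row3; rewrite !mxE /=; ring.
Qed.

Lemma Omega_roots (x : Omega R) : exists v, [/\ admissible v,
  root_class (piM x) = piS3 (pt v) & j_inv (val x) = j_row v].
Proof.
have o0 : (1 : C) != 0 by rewrite oner_eq0.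
have [v [E [e [av sv _ _ _]]]] :=
  @pencil_perturbation x (conic_mx (val x).1) (conic_mx (val x).2) 1 1 o0 o0
    (esym (scale1r _)) (esym (scale1r _)).
exists v; split=> //; first exact: root_classE (admissible_neq0 av) sv.
exact: (j_pencil_splits sv).
Qed.

(** This is why j descends to the moduli space: [j_row] is invariant under scaling and permuting the
    roots. *)
Lemma root_class_j (x : Omega R) u : u != 0 -> root_class (piM x) = piS3 (pt u) ->
  admissible u /\ j_inv (val x) = j_row u.
Proof.
have [v [av -> ->]] := Omega_roots x.
move=> u0 /esym /(piS3_eqP u0 (admissible_neq0 av))[k k0 [s ->]].
by split; [exact: admissible_perm|rewrite j_row_perm].
Qed.

Lemma conic_mx_pt A : A^T = A -> A != 0 ->
  exists2 k : C, k != 0 & conic_mx (pt (sym_vec A)) = k *: A.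
Proof.
move=> sA A0; have v0 : sym_vec A != 0.
  apply: contraNneq A0 => e; rewrite -(sym_vecK sA) e.
  by apply/eqP/matrixP => i j; rewrite !mxE.
have [k k0 e] := hc_pt v0; exists k => //.
by rewrite /conic_mx e sym_mxZ sym_vecK.
Qed.

(** The default value of [nth] supplies the unit point at index 3. *)
Definition four_points (i : nat) : 'rV[C]_3 :=
  nth (row3 1 1 1) [:: row3 1 0 0; row3 0 1 0; row3 0 0 1] i.

Lemma four_points_neq0 i : four_points i != 0.
Proof.
apply/eqP => /rowP h; case: i h => [|[|[|i]]] h;
  [have := h 0|have := h 1|have := h 2%R|have := h 0];
  by rewrite /four_points /= ?nth_nil !mxE /= => /eqP; rewrite oner_eq0.
Qed.

Lemma four_points_inj : {in `I_4 &, injective (fun i => pt (four_points i) : CP R 2)}.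
Proof.
move=> i j; rewrite !inE /= => i4 j4 /(pt_eqP (four_points_neq0 i) (four_points_neq0 j)).
move=> [k k0 e].
have H l : (four_points i 0 l == 0) = (four_points j 0 l == 0).
  by rewrite e mxE mulf_eq0 (negPf k0).
have := H 0; have := H 1; have := H 2%R.
case: i i4 {e H} => [|[|[|[|//]]]] _; case: j j4 => [|[|[|[|//]]]] _ //;
  by rewrite !mxE /= ?oner_eq0 ?eqxx.
Qed.

(** For coordinates x, y, z with xy = xz = yz: if x = 0 then yz = 0; otherwise y = z and (x - y) y =
    0. *)
Lemma four_points_cases (z : 'rV[C]_3) : z != 0 ->
  z 0 0 * z 0 1 = z 0 0 * z 0 2%R -> z 0 0 * z 0 1 = z 0 1 * z 0 2%R ->
  exists2 i, (i < 4)%N & exists k, z = k *: four_points i.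
Proof.
move=> z0; have rE := row3E z; have scale (k a b c : C) :
    k *: row3 a b c = row3 (k * a) (k * b) (k * c).
  by apply/rowP; apply: ord3_forall; rewrite !mxE.
move: (z 0 0) (z 0 1) (z 0 2%R) rE => a b c zE.
have [a0|a0] := eqVneq a 0.
  rewrite a0 !mul0r => _ /esym /eqP; rewrite mulf_eq0 => /orP[/eqP b0|/eqP c0].
    by exists 2%N => //; exists c; rewrite scale zE a0 b0 mulr0 mulr1.
  by exists 1%N => //; exists b; rewrite scale zE a0 c0 mulr0 mulr1.
move=> /(mulfI a0) bc; rewrite -{c}bc in zE *; move/eqP; rewrite -subr_eq0 -mulrBl mulf_eq0 subr_eq0.
move=> /orP[/eqP ab|/eqP b0].
  by exists 3%N => //; exists a; rewrite scale zE -ab mulr1.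
by exists 0%N => //; exists a; rewrite scale zE b0 mulr0 mulr1.
Qed.

Lemma pairs_with_roots v : admissible v ->
  exists x : Omega R, root_class (piM x) = piS3 (pt v).
Proof.
move=> av; have [v0 vi] := av; have [n01 n12 n02] := admissible_neq av.
(* Both the sum of the c_i and the sum of the v_i c_i vanish, so the conics with entries c_i and -
   v_i c_i pass through [1 : 1 : 1]; the roots, minus the quotients of entries, are the v_i. *)
pose c1 := v 0 1 - v 0 2%R; pose c2 := v 0 2%R - v 0 0; pose c3 := v 0 0 - v 0 1.
have c10 : c1 != 0 by rewrite subr_eq0.
have c20 : c2 != 0 by rewrite subr_eq0 eq_sym.
have c30 : c3 != 0 by rewrite subr_eq0.
pose A := offdiag_mx c1 c2 c3.
pose B := offdiag_mx (- (v 0 0 * c1)) (- (v 0 1 * c2)) (- (v 0 2%R * c3)).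
have dA : \det A != 0 by rewrite det_offdiag !mulf_neq0 ?pnatr_eq0.
have dB : \det B != 0 by rewrite det_offdiag !mulf_neq0 ?oppr_eq0 ?mulf_neq0 ?pnatr_eq0.
have nz M : \det M != 0 -> M != 0 :> 'M[C]_3.
  by apply: contraNneq => ->; rewrite det0.
have [a a0 eA] := conic_mx_pt (offdiag_mx_sym _ _ _) (nz _ dA).
have [b b0 eB] := conic_mx_pt (offdiag_mx_sym _ _ _) (nz _ dB).
rewrite -/A -/B in eA eB.
have isoZ (k : C) M p : k != 0 -> isotropic (k *: M) p <-> isotropic M p.
  move=> k0; rewrite /isotropic -scalemxAr -scalemxAl; split=> [/eqP|->].
    by rewrite scaler_eq0 (negPf k0) => /eqP.
  by rewrite scaler0.
have onE p : p != 0 ->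
    (on_conic (pt (sym_vec A)) (pt p) /\ on_conic (pt (sym_vec B)) (pt p)) <->
    (isotropic A p /\ isotropic B p).
  by move=> p0; rewrite !(on_conic_pt _ p0) eA eB !isoZ.
have SE : [set p | on_conic (pt (sym_vec A)) p /\ on_conic (pt (sym_vec B)) p] =
    (fun i => pt (four_points i) : CP R 2) @` `I_4.
  apply/seteqP; split=> [p|_ [i i4 <-]] /=; last first.
    apply/(onE _ (four_points_neq0 i)); split; apply/isotropic_offdiag;
      by case: i i4 => [|[|[|[|//]]]] _; rewrite !mxE /= /c1 /c2 /c3; ring.
  rewrite -[p]hcK => /(onE _ (hc_neq0 p))[/isotropic_offdiag iA /isotropic_offdiag iB].
  have z0 := hc_neq0 p; set z := hc p in iA iB z0 *.
  set x := z 0 0 * z 0 1; set y := z 0 0 * z 0 2%R; set w := z 0 1 * z 0 2%R.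
  have {}iA : c1 * x + c2 * y + c3 * w = 0 by rewrite -iA /x /y /w; ring.
  have {}iB : v 0 0 * c1 * x + v 0 1 * c2 * y + v 0 2%R * c3 * w = 0.
    by apply: oppr_inj; rewrite oppr0 -iB /x /y /w; ring.
  (* Eliminating [w], and then [y], between the two linear equations gives x = y = w. *)
  have xy : x = y.
    apply/eqP; rewrite -subr_eq0; have : c1 * c2 * (x - y) = 0.
      transitivity (v 0 2%R * (c1 * x + c2 * y + c3 * w) -
        (v 0 0 * c1 * x + v 0 1 * c2 * y + v 0 2%R * c3 * w)).
        by rewrite /c1 /c2 /c3; ring.
      by rewrite iA iB mulr0 subr0.
    by move/eqP; rewrite !mulf_eq0 (negPf c10) (negPf c20).
  have xw : x = w.
    apply/eqP; rewrite -subr_eq0; have : c1 * c3 * (x - w) = 0.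
      transitivity ((v 0 0 * c1 * x + v 0 1 * c2 * y + v 0 2%R * c3 * w) -
        v 0 1 * (c1 * x + c2 * y + c3 * w)).
        by rewrite /c1 /c2 /c3; ring.
      by rewrite iA iB mulr0 subr0.
    by move/eqP; rewrite !mulf_eq0 (negPf c10) (negPf c30).
  have [i i4 [k zk]] := four_points_cases z0 xy xw.
  exists i => //; apply/esym/pt_eqP; rewrite ?four_points_neq0 //; exists k => //.
  by apply: contraNneq z0 => k0; rewrite zk k0 scale0r.
have xO : (pt (sym_vec A), pt (sym_vec B)) \in (@Opairs R).
  rewrite inE; split; rewrite /= /Defs.nondegenerate.
  - by rewrite eA detZ mulf_neq0 ?expf_neq0.
  - by rewrite eB detZ mulf_neq0 ?expf_neq0.
  - by rewrite /transverse SE; apply: inj_card_eq; exact: four_points_inj.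
pose x : Omega R := exist (fun y => y \in @Opairs R) _ xO.
exists x.
have sv : splits_at A B v.
  have := splits_at_offdiag (- (v 0 0 * c1)) (- (v 0 1 * c2)) (- (v 0 2%R * c3)) c10 c20 c30.
  by rewrite !mulNr !mulfK // !opprK -row3E.
by apply: (root_class_scaled a0 b0 _ _ _ sv) => //; exact: admissible_neq0.
Qed.

End Existence.

(** * Affine charts *)

Section Charts.
Context {R : realType}.
Local Notation C := (Cx R).

Definition affine_lift n (k : 'I_n.+1) (w : 'rV[C]_n) : 'rV[C]_n.+1 :=
  \row_i oapp (w 0) 1 (unlift k i).

Lemma affine_lift_neq0 n (k : 'I_n.+1) (w : 'rV[C]_n) : affine_lift k w != 0.
Proof.
apply/eqP => /rowP /(_ k); rewrite !mxE unlift_none /= => /eqP.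
by rewrite oner_eq0.
Qed.

(** A displacement [d] of homogeneous coordinates may leave the slice where coordinate [k] is 1.
    Subtracting [d 0 k] times the base point brings it back, at the cost of the factor
    [1 - t * d 0 k]. *)
Lemma affine_lift_line n (k : 'I_n.+1) (v : 'rV[C]_n) (d : 'rV[C]_n.+1) (t : C) :
  affine_lift k (t *: (\row_j (d - d 0 k *: affine_lift k v) 0 (lift k j)) + v) =
  (1 - t * d 0 k) *: affine_lift k v + t *: d.
Proof.
apply/rowP => i; rewrite !mxE; case: (unliftP k i) => [j ->|->] /=.
  by rewrite !mxE liftK /=; ring.
by ring.
Qed.

Lemma chart_surj n (p : CP R n) : exists k w, chart k w = p.
Proof.
have p0 := hc_neq0 p.
have [k hk] : exists k, hc p 0 k != 0.
  apply/existsP; apply: contraNT p0; rewrite negb_exists => /forallP h.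
  by apply/eqP/rowP => i; rewrite mxE; apply/eqP; rewrite -[_ == _]negbK.
exists k, (\row_j (hc p 0 (lift k j) / hc p 0 k)).
rewrite -[RHS]hcK; apply/pt_eqP => //; first exact: affine_lift_neq0.
exists (hc p 0 k)^-1; first by rewrite invr_eq0.
apply/rowP => i; rewrite !mxE; case: (unliftP k i) => [j ->|->] /=.
  by rewrite !mxE mulrC.
by rewrite mulVf.
Qed.

Lemma differentiable_affine_lift n (V : normedModType C) (f : V -> 'rV[C]_n)
    (k : 'I_n.+1) i v : differentiable f v ->
  differentiable (fun w => affine_lift k (f w) 0 i) v.
Proof.
move=> df; rewrite (_ : (fun w => _) = fun w => oapp (f w 0) 1 (unlift k i)); last first.
  by apply/funext => w; rewrite mxE.
case: (unlift k i) => [j|] /=; last exact: differentiable_cst.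
exact: (differentiable_comp (g := fun N : 'rV[C]_n => N 0 j : C) df
  (differentiable_coord _ _ _)).
Qed.

Definition chart_mx (k : 'I_6) (w : 'rV[C]_5) : 'M[C]_3 := sym_mx (affine_lift k w).

Lemma conic_mx_chart k w : exists2 a : C, a != 0 &
  conic_mx (chart k w) = a *: chart_mx k w.
Proof.
have [a a0 e] := hc_pt (affine_lift_neq0 k w); exists a => //.
by rewrite /conic_mx /chart e sym_mxZ.
Qed.

Lemma j_inv_chart2 kl (w : 'rV[C]_5 * 'rV[C]_5) : j_inv (chart2 kl w) =
  j_pencil (chart_mx kl.1 w.1) (chart_mx kl.2 w.2).
Proof.
have [a a0 ea] := conic_mx_chart kl.1 w.1; have [b b0 eb] := conic_mx_chart kl.2 w.2.
by rewrite -[LHS]/(j_pencil (conic_mx (chart kl.1 w.1)) (conic_mx (chart kl.2 w.2)))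
  ea eb j_pencilZ.
Qed.

Lemma differentiable_proj1 (V W : normedModType C) (v : V * W) :
  differentiable (fst : V * W -> V) v.
Proof. apply: linear_differentiable => x; exact: cvg_fst. Qed.

Lemma differentiable_proj2 (V W : normedModType C) (v : V * W) :
  differentiable (snd : V * W -> W) v.
Proof. apply: linear_differentiable => x; exact: cvg_snd. Qed.

Lemma chart_perturbation (x : Omega R) kl (v : 'rV[C]_5 * 'rV[C]_5) :
  chart2 kl v = val x ->
  exists u E e, [/\ admissible u, splits_at (chart_mx kl.1 v.1) (chart_mx kl.2 v.2) u,
    E^T = E & e != 0] /\
  root_class (piM x) = piS3 (pt u) /\
  forall s t, j_pencil (chart_mx kl.1 v.1) (s *: chart_mx kl.2 v.2 + t *: E) =
    j_row (row3 (s * u 0 0 + t * e) (s * u 0 1) (s * u 0 2%R)).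
Proof.
move=> xv; have [a a0 ea] := conic_mx_chart kl.1 v.1.
have [b b0 eb] := conic_mx_chart kl.2 v.2.
rewrite -[chart _ _]/((chart2 kl v).1) xv in ea.
rewrite -[chart _ _]/((chart2 kl v).2) xv in eb.
have [u [E [e [au su sE e0 jE]]]] := pencil_perturbation a0 b0 ea eb.
exists u, E, e; split=> //; split=> //.
by apply: (root_class_scaled a0 b0 _ ea eb su); exact: admissible_neq0.
Qed.

(** In a chart the coefficients of the pencil are polynomial; dividing by the leading one,
    [\det (A w)], gives [a], [b], [c]. The discriminant at [v] is non-zero because the roots are
    distinct. *)
Lemma j_inv_chart2_cubic (x : Omega R) kl (v : 'rV[C]_5 * 'rV[C]_5) :
  chart2 kl v = val x -> exists a b c : 'rV[C]_5 * 'rV[C]_5 -> C,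
  [/\ differentiable a v, differentiable b v, differentiable c v,
    j_den (a v) (b v) (c v) != 0 &
    j_inv \o chart2 kl = fun w => j_cubic (a w) (b w) (c w)].
Proof.
move=> xv; have [u [E [e [[au su _ _] _]]]] := chart_perturbation xv.
pose A (w : 'rV[C]_5 * 'rV[C]_5) := chart_mx kl.1 w.1.
pose B (w : 'rV[C]_5 * 'rV[C]_5) := chart_mx kl.2 w.2.
have dA i j : differentiable (fun w => A w i j) v.
  rewrite (_ : (fun w => _) = fun w => affine_lift kl.1 w.1 0 (entry_index i j)).
    exact: (differentiable_affine_lift _ _ (differentiable_proj1 v)).
  by apply/funext => w; rewrite mxE.
have dB i j : differentiable (fun w => B w i j) v.
  rewrite (_ : (fun w => _) = fun w => affine_lift kl.2 w.2 0 (entry_index i j)).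
    exact: (differentiable_affine_lift _ _ (differentiable_proj2 v)).
  by apply/funext => w; rewrite mxE.
have [k k0 [e3 e2 e1 e0]]  := splits_at_coefs su.
have ddA : differentiable (fun w => \det (A w)) v.
  by under eq_fun do rewrite det3; solve_diff.
have ddB : differentiable (fun w => \det (B w)) v.
  by under eq_fun do rewrite det3; solve_diff.
have dm1 : differentiable (fun w => mixed_det (A w) (B w)) v.
  by rewrite /mixed_det; solve_diff.
have dm2 : differentiable (fun w => mixed_det (B w) (A w)) v.
  by rewrite /mixed_det; solve_diff.
have dAn0 : \det (A v) != 0 by rewrite /A e3.
exists (fun w => mixed_det (A w) (B w) / \det (A w)),
  (fun w => mixed_det (B w) (A w) / \det (A w)), (fun w => \det (B w) / \det (A w)).
split.
- by solve_diff.
- by solve_diff.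
- by solve_diff.
- rewrite /A /B e3 e2 e1 e0 ![k * _]mulrC !mulfK // j_den_roots.
  have [n01 n12 n02] := admissible_neq au.
  by rewrite expf_neq0 // !mulf_neq0 // subr_eq0.
- by apply/funext => w; rewrite /= j_inv_chart2 j_pencilE.
Qed.

End Charts.

(** * Submersions and critical values *)

Section Submersion.
Context {R : realType}.
Local Notation C := (Cx R).

Lemma holomorphic_pairs_j (x : Omega R) : holomorphic_pairs_at j_inv x.
Proof.
move=> kl v /j_inv_chart2_cubic[a [b [c [da db dc d0 ->]]]].
exact: differentiable_j_cubic.
Qed.

Lemma submersion_pairs_j (x : Omega R) :
  ~ curveX R (piM x) -> submersion_pairs_at j_inv x.
Proof.
move=> nX; split; first exact: holomorphic_pairs_j.
move=> kl v xv.
have [u [E [e [[au su sE e0] [xu jE]]]]] := chart_perturbation xv.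
have [n01 n12 n02] := admissible_neq au.
pose d := sym_vec E; pose k := d 0 kl.2.
(* The tangent vector of the chart that represents the perturbation [E]; only the second conic
   moves. *)
pose u2 : 'rV[C]_5 := \row_j (d - k *: affine_lift kl.2 v.2) 0 (lift kl.2 j).
have line t : (j_inv \o chart2 kl) (t *: (0, u2) + v) =
    j_roots (u 0 0 + t * (e - k * u 0 0)) (u 0 1 + t * (- (k * u 0 1)))
      (u 0 2%R + t * (- (k * u 0 2%R))).
  rewrite /= j_inv_chart2 /=.
  have -> : t *: 0 + v.1 = v.1 by rewrite scaler0 add0r.
  rewrite {2}/chart_mx affine_lift_line -/k.
  have -> : sym_mx ((1 - t * k) *: affine_lift kl.2 v.2 + t *: d) =
      (1 - t * k) *: chart_mx kl.2 v.2 + t *: E.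
    by rewrite /chart_mx -(sym_vecK sE) -/d; apply/matrixP => i j; rewrite !mxE.
  by rewrite jE /j_row; congr j_roots; rewrite mxE /=; ring.
have dv := holomorphic_pairs_j xv.
apply: (diff_onto (u := (0, u2))); apply: (diff_j_roots_neq0 dv line) => //.
- by move=> Xu; apply: nX; exists u => //; exact: admissible_neq0.
(* The common scaling of the roots by [1 - t * k] drops out of the determinant. *)
- rewrite (_ : _ + _ = e * (u 0 1 - u 0 2%R)); last by ring.
  by rewrite mulf_neq0 // subr_eq0.
Qed.

Definition j_moduli (m : moduli R) : C := j_inv (val (repr m)).

Lemma j_moduliE (x : Omega R) : j_inv (val x) = j_moduli (piM x).
Proof.
have [v [av ev ->]] := Omega_roots x.
have e : piM (repr (piM x)) = piM x by exact: reprK.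
by rewrite -e in ev; have [_ jv] := root_class_j (admissible_neq0 av) ev; rewrite /j_moduli jv.
Qed.

Lemma root_class_j_moduli (m : moduli R) u : u != 0 ->
  root_class m = piS3 (pt u) -> admissible u /\ j_moduli m = j_row u.
Proof.
move=> u0; have <- : piM (repr m) = m by exact: reprK.
by rewrite -j_moduliE; exact: root_class_j.
Qed.

(** By [pairs_with_roots] the class of [u] is attained, so [xget] does not return its default 0. *)
Lemma on_quotient_j u : admissible u -> on_quotient j_moduli (piS3 (pt u)) = j_row u.
Proof.
move=> au; have [x xu] := pairs_with_roots au; rewrite /on_quotient.
case: xgetP => [_ -> [m mu <-]|/(_ (j_moduli (piM x)))].
  by have [_ ->] := root_class_j_moduli (admissible_neq0 au) mu.
by case; exists (piM x).
Qed.

Lemma differentiable_j_row_chart k (v : 'rV[C]_2) : admissible (affine_lift k v) ->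
  differentiable (fun w => j_row (affine_lift k w)) v.
Proof.
move=> av; have [n01 n12 n02] := admissible_neq av.
have dl i : differentiable (fun w => affine_lift k w 0 i) v.
  exact: differentiable_affine_lift.
rewrite /j_row /j_roots; apply: differentiable_j_cubic; try by solve_diff.
by rewrite j_den_roots expf_neq0 // !mulf_neq0 // subr_eq0.
Qed.

Lemma near_on_quotient_j k (v : 'rV[C]_2) : admissible (affine_lift k v) ->
  \near v, j_row (affine_lift k v) = (on_quotient j_moduli \o quotient_chart k) v.
Proof.
move=> av; have [n01 n12 n02] := admissible_neq av.
pose l i w := affine_lift k w 0 i : C.
have dl i : differentiable (l i) v by exact: differentiable_affine_lift.
(* [g] is non-zero exactly at admissible points, which makes admissibility an open condition. *)
pose g w := l 0 w * l 1 w * l 2%R w *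
  ((l 0 w - l 1 w) * (l 1 w - l 2%R w) * (l 0 w - l 2%R w)).
have dg : differentiable g v by rewrite /g; solve_diff.
have g0 : g v != 0.
  by rewrite /g !mulf_neq0 ?subr_eq0 // /l; case: av => ? _.
have gn : \near v, g v != 0.
  exact: (cvgr_neq0 _ (differentiable_continuous dg) g0).
move: gn; apply: filter_app; near=> w; rewrite /g !mulf_eq0 !negb_or !subr_eq0.
move=> /andP[/andP[/andP[? ?] ?] /andP[/andP[? ?] ?]] /=.
rewrite /quotient_chart /chart on_quotient_j //.
by rewrite -/(affine_lift k w) (row3E (affine_lift k w)); exact: admissible_row3.
Unshelve. all: by end_near. Qed.

Lemma quotient_chart_admissible (m : moduli R) k v :
  quotient_chart k v = root_class m ->
  admissible (affine_lift k v) /\ j_moduli m = j_row (affine_lift k v).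
Proof. by move=> e; apply: root_class_j_moduli; rewrite ?affine_lift_neq0. Qed.

Lemma holomorphic_moduli_j (m : moduli R) : holomorphic_moduli_at j_moduli m.
Proof.
move=> k v /quotient_chart_admissible[av _].
exact: near_eq_differentiable (near_on_quotient_j av) (differentiable_j_row_chart av).
Qed.

Lemma submersion_moduli_j (m : moduli R) :
  ~ curveX R m -> submersion_moduli_at j_moduli m.
Proof.
move=> nX; split; first exact: holomorphic_moduli_j.
move=> k v kv; have [av _] := quotient_chart_admissible kv.
have dv := differentiable_j_row_chart av.
have [n01 n12 n02] := admissible_neq av.
(* Moving the first chart coordinate moves the single root of index [lift k 0]; the determinant is
   then, up to sign, the difference of the other two roots. *)
pose b i : C := (i == lift k 0)%:R.
have l i t : affine_lift k (t *: delta_mx 0 0 + v) 0 i = affine_lift k v 0 i + t * b i.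
  rewrite !mxE /b; case: (unliftP k i) => [j ->|->] /=.
    by rewrite !mxE /= addrC (inj_eq lift_inj).
  by rewrite (negPf (neq_lift _ _)) mulr0 addr0.
have line t : j_row (affine_lift k (t *: delta_mx 0 0 + v)) =
    j_roots (affine_lift k v 0 0 + t * b 0) (affine_lift k v 0 1 + t * b 1)
      (affine_lift k v 0 2%R + t * b 2%R) by rewrite /j_row !l.
apply: (diff_onto (u := delta_mx 0 0)).
rewrite -(near_eq_diff (near_on_quotient_j av) dv).
apply: (diff_j_roots_neq0 dv line n01 n12 n02).
- move=> Xu; apply: nX; exists (affine_lift k v); first exact: affine_lift_neq0.
  by split=> //; rewrite -kv.
- rewrite /b; move: (lift k 0); apply: ord3_forall => /=;
    by rewrite ?mul1r ?mul0r ?addr0 ?add0r subr_eq0 // eq_sym.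
Qed.

Lemma curveX_j (m : moduli R) : curveX R m -> j_moduli m = 0 \/ j_moduli m = 1728.
Proof.
move=> [l l0 [lm Xl]]; have [al ->] := root_class_j_moduli l0 lm.
by have [? ? ?] := admissible_neq al; exact: j_roots_X.
Qed.

Lemma critical_moduli_j (m : moduli R) :
  j_moduli m = 0 \/ j_moduli m = 1728 -> ~ submersion_moduli_at j_moduli m.
Proof.
move=> jm [_ sub].
have [v [av mv _]] := Omega_roots (repr m).
have em : piM (repr m) = m by exact: reprK.
have [k [w kw]] := chart_surj (pt v).
have qw : quotient_chart k w = root_class m by rewrite -em mv /quotient_chart kw.
have [aw jw] := quotient_chart_admissible qw.
(* A zero differential cannot take the value 1. *)
have [u] := sub k w qw 1; apply/eqP; rewrite eq_sym.
have dw := differentiable_j_row_chart aw.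
rewrite -(near_eq_diff (near_on_quotient_j aw) dw).
have [n01 n12 n02] := admissible_neq aw.
have dl i : differentiable (fun w => affine_lift k w 0 i) w.
  exact: differentiable_affine_lift.
rewrite jw in jm.
have d0 := j_den_roots (affine_lift k w 0 0) (affine_lift k w 0 1) (affine_lift k w 0 2%R).
have -> : 'd (fun w => j_row (affine_lift k w)) w u = 0.
  apply: (diff_j_cubic_critical (a := fun w => _) (b := fun w => _) (c := fun w => _)
    _ _ _ _ jm); [by solve_diff|by solve_diff|by solve_diff|].
  by rewrite d0 expf_neq0 // !mulf_neq0 // subr_eq0.
by rewrite oner_eq0.
Qed.

Lemma critical_pairs_j (x : Omega R) :
  j_inv (val x) = 0 \/ j_inv (val x) = 1728 -> ~ submersion_pairs_at j_inv x.
Proof.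
move=> jx [_ sub].
have [k [v kv]] := chart_surj (val x).1; have [l [w lw]] := chart_surj (val x).2.
have xE : chart2 (k, l) (v, w) = val x by rewrite /chart2 kv lw; case: (val x).
have [u] := sub (k, l) (v, w) xE 1; apply/eqP; rewrite eq_sym.
have [a [b [c [da db dc d0 e]]]] := j_inv_chart2_cubic xE.
have ev : j_inv (val x) = j_cubic (a (v, w)) (b (v, w)) (c (v, w)).
  by rewrite -xE -[LHS]/((j_inv \o chart2 (k, l)) (v, w)) e.
by rewrite ev in jx; rewrite e (diff_j_cubic_critical da db dc d0 jx) oner_eq0.
Qed.

Lemma j_values (z : C) : z = 0 \/ z = 1728 -> exists x : Omega R, j_inv (val x) = z.
Proof.
move=> zv; suff [v [av <-]] : exists v, admissible v /\ j_row v = z.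
  have [x xv] := pairs_with_roots av; exists x.
  by have [_] := root_class_j (admissible_neq0 av) xv.
case: zv => ->.
(* The roots 1, w, w^2 = - 1 - w, with w a primitive cube root of unity, annihilate q. *)
- pose s : C := sqrtC (- 3); have s2 : s ^+ 2 = - 3 by rewrite sqrtCK.
  have n2 : (2 : C) != 0 by rewrite pnatr_eq0.
  have n3 : (3 : C) != 0 by rewrite pnatr_eq0.
  pose w := (s - 1) / 2; have w2 : w ^+ 2 = - w - 1.
    apply/eqP; rewrite -subr_eq0; apply/eqP; transitivity ((s ^+ 2 + 3) / 4).
      by rewrite /w; field.
    by rewrite s2 addNr mul0r.
  clearbody w; have o0 : (1 : C) != 0 := oner_neq0 _.
  exists (row3 1 w (- 1 - w)); split; last first.
    rewrite /j_row !mxE /= j_rootsE (_ : _ + _ = 3 * (w ^+ 2 + w + 1)); last by ring.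
    have -> : w ^+ 2 + w + 1 = 0 by rewrite w2; ring.
    by rewrite mulr0 expr0n /= mulr0 mul0r.
  (* Any zero or coincidence among the roots would express 1 or 3 as a multiple of w^2 + w + 1 =
     0. *)
  have ne (p q r : C) : q != 0 -> q = r * (p * (w ^+ 2 + w + 1)) -> False.
    by rewrite w2 => q0 e; move: q0; rewrite e (_ : - w - 1 + w + 1 = 0) ?mulr0 ?eqxx //; ring.
  apply: admissible_row3 => //; apply/eqP => e.
  + by apply: (ne 1 1 1 o0); rewrite e; ring.
  + have {}e : w = - 1 by apply/eqP; rewrite -subr_eq0 opprK -oppr_eq0 opprD addrC e.
    by apply: (ne 1 1 1 o0); rewrite e; ring.
  + by apply: (ne 1 3 1 n3); rewrite -e; ring.
  + apply: (ne 4 3 1 n3); transitivity ((w - (- 1 - w)) ^+ 2 + 3 : C); last by ring.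
    by rewrite {1}e subrr expr0n /= add0r.
  + have {}e : w = - 2 by rewrite -[w]opprK -[- w](addKr (- 1)) -e opprK; ring.
    by apply: (ne 1 3 1 n3); rewrite e; ring.
- have neq (m n : nat) : m != n -> (m%:R : C) != n%:R by rewrite eqr_nat.
  (* Equally spaced roots annihilate S, since 1 - 2 * 2 + 3 = 0. *)
  exists (row3 1 2 3); split; last by rewrite /j_row !mxE /= j_rootsE; field.
  by apply: admissible_row3; rewrite ?oner_eq0 ?pnatr_eq0 //;
    [exact: (neq 1%N 2%N)|exact: (neq 2%N 3%N)|exact: (neq 1%N 3%N)].
Qed.

End Submersion.

Theorem theorem4 (R : realType) :
  (forall x : Omega R, holomorphic_pairs_at j_inv x) /\
  exists jbar : moduli R -> Cx R,
    (forall x : Omega R, j_inv (val x) = jbar (piM x)) /\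
    (forall m : moduli R, holomorphic_moduli_at jbar m) /\
    (forall m : moduli R, ~ curveX R m -> submersion_moduli_at jbar m) /\
    critical_values_moduli jbar = [set 0; 1728] /\
    critical_values_pairs (@j_inv R) = [set 0; 1728] /\
    (forall x : Omega R, ~ curveX R (piM x) -> submersion_pairs_at j_inv x).
Proof.
split; first exact: holomorphic_pairs_j.
exists (@j_moduli R); split; first exact: j_moduliE.
split; first exact: holomorphic_moduli_j.
split; first exact: submersion_moduli_j.
split; last split; last exact: submersion_pairs_j.
(* A critical point lies on X, where the value is 0 or 1728; conversely both values are attained,
   and every point with such a value is critical. *)
- apply/seteqP; split=> [_ [m nsub <-]|z zv].
    by apply: curveX_j; apply: contrapT => /submersion_moduli_j.
  have [x xz] := j_values zv; exists (piM x); last by rewrite -j_moduliE.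
  by apply: critical_moduli_j; rewrite -j_moduliE xz.
- apply/seteqP; split=> [_ [x nsub <-]|z zv].
    by rewrite j_moduliE; apply: curveX_j; apply: contrapT => /submersion_pairs_j.
  have [x xz] := j_values zv; exists x => //.
  by apply: critical_pairs_j; rewrite xz.
Qed.
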